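(* Suppose that $\mathcal{M}$ is a countable, binary, homogeneous and simple structure. Let $T$ be the complete theory of $\mathcal{M}$, and let $S_2(T)$ be the set of complete 2-types over $\emptyset$ with respect to $T$. Then $T$ is supersimple with finite SU-rank which is at most $|S_2(T)|$.
   Context: A first-order structure $\mathcal{M}$ is called homogeneous if it is countable, has a finite vocabulary with only relation symbols (a finite relational vocabulary), and every isomorphism between finite substructures of $\mathcal{M}$ can be extended to an automorphism of $\mathcal{M}$. A structure is binary if its vocabulary has only relation symbols that are unary or binary. A structure is called simple if it is infinite and its complete first-order theory is simple. For a complete theory $T$ and $n<\omega$, $S_n(T)$ denotes the set of all complete $n$-types of $T$ without parameters. For a simple theory $T$, the SU-rank $\mathrm{SU}(p)$ of a complete type $p$ (over any set of parameters) is the usual foundation rank of dividing (forking) extensions; it is an ordinal or $\infty$ (undefined). $T$ is supersimple if every type has ordinal-valued SU-rank. The SU-rank of $T$ is the supremum of $\{\mathrm{SU}(p) : p \in S_1(T)\}$, i.e. only 1-types over $\emptyset$ of real elements are considered. *)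

(* Defs.v *)
From mathcomp Require Import all_boot.
From mathcomp Require Import boolp classical_sets functions cardinality.

Set Implicit Arguments.
Unset Strict Implicit.
Unset Printing Implicit Defensive.

Local Open Scope classical_set_scope.
Local Open Scope card_scope.

Record vocabulary := Vocabulary {
  symb : Type;
  arity : symb -> nat
}.

Definition binary (L : vocabulary) : Prop :=
  forall r : symb L, arity r = 1 \/ arity r = 2.

Record structure (L : vocabulary) := Structure {
  carrier :> Type;
  interp : forall r : symb L, ('I_(arity r) -> carrier) -> Prop
}.

(* [form L V]: first-order formulas with equality whose free variables are
   taken from [V]; the variable bound by [Fall] is [None]. As satisfaction is
   classical, the other connectives are definable. *)
Inductive form (L : vocabulary) (V : Type) : Type :=
| Fbot
| Feq (x y : V)
| Frel (r : symb L) (t : 'I_(arity r) -> V)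
| Fimp (f g : form L V)
| Fall (f : form L (option V)).

Arguments Fbot {L V}.
Arguments Feq {L V} x y.
Arguments Frel {L V} r t.
Arguments Fimp {L V} f g.
Arguments Fall {L V} f.

Fixpoint rename (L : vocabulary) (V : Type) (f : form L V) :
    forall W : Type, (V -> W) -> form L W :=
  match f with
  | Fbot => fun W h => Fbot
  | Feq x y => fun W h => Feq (h x) (h y)
  | Frel r t => fun W h => Frel r (h \o t)
  | Fimp f1 f2 => fun W h => Fimp (rename f1 h) (rename f2 h)
  | Fall f1 => fun W h => Fall (rename f1 (omap h))
  end.

Fixpoint sat (L : vocabulary) (N : structure L) (V : Type) (f : form L V) :
    (V -> N) -> Prop :=
  match f with
  | Fbot => fun v => False
  | Feq x y => fun v => v x = v y
  | Frel r t => fun v => interp (v \o t)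
  | Fimp f1 f2 => fun v => sat f1 v -> sat f2 v
  | Fall f1 => fun v => forall a : N, sat f1 (oapp v a)
  end.

Definition sentence (L : vocabulary) := form L void.

Definition Th (L : vocabulary) (M : structure L) : set (sentence L) :=
  [set f | sat f (of_void M)].

Definition models (L : vocabulary) (T : set (sentence L)) (N : structure L) :=
  T `<=` Th N.

Definition elementary (L : vocabulary) (N N' : structure L) (e : N -> N') :=
  forall (n : nat) (f : form L 'I_n) (v : 'I_n -> N),
    sat f v <-> sat f (e \o v).

Definition partial_iso (L : vocabulary) (M : structure L) (A B : set M)
    (f : M -> M) : Prop :=
  set_bij A B f /\
  forall (r : symb L) (t : 'I_(arity r) -> M), (forall i, A (t i)) ->
    (interp t <-> interp (f \o t)).

Definition automorphism (L : vocabulary) (M : structure L) (g : M -> M) :=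
  bijective g /\
  forall (r : symb L) (t : 'I_(arity r) -> M), interp t <-> interp (g \o t).

(* The vocabulary being relational, the finite substructures of [M] are its
   finite subsets; only the restriction of [f] to [A] matters. *)
Definition homogeneous (L : vocabulary) (M : structure L) : Prop :=
  [/\ countable [set: M], finite_set [set: symb L] &
    forall (A B : set M) (f : M -> M),
      finite_set A -> finite_set B -> partial_iso A B f ->
      exists2 g : M -> M, automorphism g & forall a, A a -> g a = f a].

Definition join_env (X Y Z : Type) (f : X -> Z) (g : Y -> Z) (v : X + Y) : Z :=
  match v with inl x => f x | inr y => g y end.

Definition map_sum (X X' Y Y' : Type) (f : X -> X') (g : Y -> Y') (v : X + Y) :
    X' + Y' :=
  match v with inl x => inl (f x) | inr y => inr (g y) end.

(* The type of the tuple [c] over parameters named by [X] and interpreted in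
   [N] by [h]. *)
Definition tp (L : vocabulary) (N : structure L) (X : Type) (h : X -> N)
    (n : nat) (c : 'I_n -> N) : set (form L ('I_n + X)) :=
  [set f | sat f (join_env c h)].

(* [stone n T] is S_n(T). *)
Definition stone (L : vocabulary) (n : nat) (T : set (sentence L)) :
    set (set (form L 'I_n)) :=
  [set p | exists N : structure L, models T N /\
     exists c : 'I_n -> N, p = [set f | sat f c]].

Arguments stone {L} n T.

Definition k_inconsistent (L : vocabulary) (N : structure L) (n m k : nat)
    (f : form L ('I_n + 'I_m)) (b : nat -> 'I_m -> N) : Prop :=
  forall I : seq nat, uniq I -> size I = k ->
    ~ exists c : 'I_n -> N, forall i, i \in I -> sat f (join_env c (b i)).

(* The nodes of the tree are the finite sequences of natural numbers. *)
Definition tree_property (L : vocabulary) (T : set (sentence L)) (n m : nat)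
    (f : form L ('I_n + 'I_m)) : Prop :=
  exists (k : nat) (N : structure L) (a : seq nat -> 'I_m -> N),
    [/\ models T N,
        forall s : seq nat, k_inconsistent k f (fun i => a (rcons s i)) &
        forall (sigma : nat -> nat) (l : nat), exists c : 'I_n -> N,
          forall j, j < l -> sat f (join_env c (a (mkseq sigma j)))].

Definition simple_theory (L : vocabulary) (T : set (sentence L)) : Prop :=
  forall (n m : nat) (f : form L ('I_n + 'I_m)), ~ tree_property T f.

Definition simple_structure (L : vocabulary) (M : structure L) : Prop :=
  infinite_set [set: M] /\ simple_theory (Th M).

(* f(x, b) divides over [A]: witnessed, in an elementary extension, by a
   sequence of realisations of tp(b/A). *)
Definition divides (L : vocabulary) (N : structure L) (A : set N) (n m : nat)
    (f : form L ('I_n + 'I_m)) (b : 'I_m -> N) : Prop :=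
  exists (k : nat) (N' : structure L) (e : N -> N') (s : nat -> 'I_m -> N'),
    [/\ elementary e,
        forall i, tp (fun a : {a | A a} => e (sval a)) (s i) =
                  tp (fun a : {a | A a} => sval a) b &
        k_inconsistent k f s].

(* A complete n-type over a set [params] of parameters in the model [base]:
   the type of a tuple of some elementary extension of [base]. *)
Record ctype (L : vocabulary) (n : nat) := CType {
  base : structure L;
  params : set base;
  formulas : set (form L ('I_n + {a | params a}));
  ctypeP : exists (N : structure L) (e : base -> N) (c : 'I_n -> N),
    elementary e /\ formulas = tp (fun a : {a | params a} => e (sval a)) c
}.

Arguments params {L n} c.
Arguments formulas {L n} c.

Definition ctype_divides (L : vocabulary) (n : nat) (q : ctype L n)
    (A : set (base q)) : Prop :=
  exists (m : nat) (f : form L ('I_n + 'I_m)) (b : 'I_m -> {a | params q a}),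
    formulas q (rename f (map_sum id b)) /\
    divides A f (fun i => sval (b i)).

(* [q] is a dividing extension of [p], where the model containing the
   parameters of [q] may be an elementary extension of the one for [p]. *)
Definition dividing_ext (L : vocabulary) (n : nat) (p q : ctype L n) : Prop :=
  exists (e : base p -> base q)
         (sub : forall a, params p a -> params q (e a)),
    [/\ elementary e,
        forall f, formulas p f ->
          formulas q (rename f (map_sum id
            (fun a => exist _ (e (sval a)) (sub (sval a) (svalP a))))) &
        ctype_divides (e @` params p)].

(* Ordinals as well-founded trees: [osup f] stands for sup_i (f i + 1). *)
Inductive ord := osup (X : Type) (f : X -> ord).

Definition osucc (a : ord) : ord := osup (fun _ : unit => a).

Fixpoint onat (n : nat) : ord :=
  if n is n'.+1 then osucc (onat n') else osup (of_void ord).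

Fixpoint ole (a b : ord) : Prop :=
  match a, b with
  | @osup X f, @osup Y g => forall i : X, exists j : Y, ole (f i) (g j)
  end.

(* SU(p) >= a. With the encoding of ordinals above, the clauses for 0,
   successors and limits merge into one: SU(p) >= a iff for every b < a some
   dividing extension q of p has SU(q) >= b. *)
Fixpoint SU_ge (L : vocabulary) (n : nat) (a : ord) (p : ctype L n) : Prop :=
  match a with
  | @osup X f => forall i : X,
      exists q : ctype L n, dividing_ext p q /\ SU_ge (f i) q
  end.

(* SU(p) = a. *)
Definition SU_eq (L : vocabulary) (n : nat) (p : ctype L n) (a : ord) : Prop :=
  SU_ge a p /\ ~ SU_ge (osucc a) p.

Definition supersimple (L : vocabulary) (T : set (sentence L)) : Prop :=
  simple_theory T /\
  forall (n : nat) (p : ctype L n), models T (base p) ->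
    exists a : ord, SU_eq p a.

(* [P] is [p] regarded as a type over the empty subset of a model of [T]. *)
Definition over_empty (L : vocabulary) (n : nat) (T : set (sentence L))
    (p : set (form L 'I_n)) (P : ctype L n) : Prop :=
  [/\ models T (base P), params P = set0 &
      forall f, p f <-> formulas P (rename f inl)].

Definition SU_bound (L : vocabulary) (T : set (sentence L)) (a : ord) : Prop :=
  forall p, stone 1 T p -> forall P : ctype L 1, over_empty T p P ->
    exists b : ord, SU_eq P b /\ ole b a.

(* The SU-rank of [T] is [a]: the supremum of SU(p) over S_1(T) is [a]. *)
Definition SU_rank_eq (L : vocabulary) (T : set (sentence L)) (a : ord) :=
  SU_bound T a /\ forall b, SU_bound T b -> ole a b.

(* Main.v *)
(* In a binary structure with quantifier elimination, the type over [B] of a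
   sequence whose members all realise [tp(c/B)] is determined by the types of
   its pairs. Along a chain [B_0, B_1, ...] with [tp(c/B_(i+1))] dividing over
   [B_i], choose for each [i] arbitrarily long independent sequences over [B_i]
   in [tp(c/B_i)] whose pairs all have one type [r_i]. If [r_i = r_j] with
   [i < j], the sequence over [B_j] is also independent over [B_i], and its
   members all have the same type over [B_j]; by Kim's lemma and symmetry [c] is
   then independent from [B_j] over [B_i], a contradiction. So the [r_i] are
   distinct types of pairs.

   Only finite parameter sets matter and they can be copied into [M], so
   simplicity theory is developed for the action of [Aut(M)] on finite tuples of
   [M], where having finitely many orbits replaces compactness. *)
Require Import Defs.
From HB Require Import structures.
From mathcomp Require Import all_boot.
From mathcomp Require Import boolp classical_sets functions cardinality.

Set Implicit Arguments.
Unset Strict Implicit.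
Unset Printing Implicit Defensive.

Local Open Scope classical_set_scope.
Local Open Scope card_scope.

(** Simplicity bounds only chains of k-dividing steps for one fixed k, whereas the steps counted by
    SU-rank each come with their own k. Hence the detour through the r_i: comparing r_i with r_j
    uses the single step i and its k, and the number of types of pairs does not depend on any k.
    Independence means non-dividing, and existence, extension and symmetry are themselves drawn from
    bounds on lengths. If all conjugates of a tuple divide, finitely many orbits supply one k for
    all of them, and with a fixed k something too long can be built. Since only pairs have to look
    alike, the pigeonhole principle suffices where indiscernibles would call for Ramsey's
    theorem. *)

Lemma map_sub (T T' : eqType) (f g : T -> T') (s s0 : seq T) :
  {subset s <= s0} -> map f s0 = map g s0 -> map f s = map g s.
Proof. by move=> ss0 /eq_in_map e; apply/eq_in_map => x /ss0 /e. Qed.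

Lemma map_id_sub (T : eqType) (f : T -> T) (s s0 : seq T) :
  {subset s <= s0} -> map f s0 = s0 -> map f s = s.
Proof.
move=> ss0 e; rewrite -[RHS]map_id; apply: (map_sub ss0).
by rewrite map_id.
Qed.

Lemma cat_inj (T : eqType) (a b a' b' : seq T) :
  size a = size a' -> a ++ b = a' ++ b' -> a = a' /\ b = b'.
Proof. by move=> sa /eqP; rewrite eqseq_cat // => /andP[/eqP-> /eqP->]. Qed.

Lemma map_zip (T T' : eqType) (g : T -> T') (a : seq T) (b : seq T') :
  size a = size b -> (forall p, p \in zip a b -> g p.1 = p.2) -> map g a = b.
Proof.
elim: a b => [|x a IH] [|y b] //= [sab] gP.
rewrite (gP (x, y)) ?mem_head // (IH b) // => p pab.
by apply: gP; rewrite inE pab orbT.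
Qed.

Lemma zip_map (T T' : eqType) (g : T -> T') (a : seq T) p :
  p \in zip a (map g a) -> p.2 = g p.1.
Proof. by elim: a => //= x a IH; rewrite inE => /orP[/eqP->|/IH]. Qed.

Lemma mem_zip (T T' : eqType) (a : seq T) (b : seq T') p :
  p \in zip a b -> p.1 \in a /\ p.2 \in b.
Proof.
elim: a b => [|x a IH] [|y b] //=; rewrite !inE => /orP[/eqP->|/IH[-> ->]].
  by rewrite !eqxx.
by rewrite !orbT.
Qed.

(** * Pigeonhole principles for finitely many colours *)

Lemma bounded_choice (P : nat) (Q : 'I_P -> nat -> Prop) :
  (forall j m n, m <= n -> Q j m -> Q j n) ->
  (forall j, exists n, Q j n) -> exists n, forall j, Q j n.
Proof.
move=> Qmono /choice[f Qf]; exists (\max_j f j) => j.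
by apply: Qmono (Qf j); rewrite leq_bigmax.
Qed.

Lemma unbounded_color (P : nat) (Q : 'I_P -> nat -> Prop) :
  (forall j m n, m <= n -> Q j n -> Q j m) ->
  (forall n, exists j, Q j n) -> exists j, forall n, Q j n.
Proof.
move=> Qmono Qe; apply: contrapT => /forallNP nQ.
have [||n nQn] := @bounded_choice P (fun j n => ~ Q j n).
- by move=> j m n mn nQm Qn; apply: nQm; apply: Qmono Qn.
- by move=> j; have /existsNP := nQ j.
by have [j /nQn] := Qe n.
Qed.

Lemma size_filter_color (T : Type) (P : nat) (f : T -> 'I_P) (s : seq T) :
  size s = \sum_j size [seq x <- s | f x == j].
Proof.
elim: s => [|x s IH] /=; first by rewrite big1.
rewrite IH [RHS](bigD1 (f x)) //= eqxx /= addSn [in LHS](bigD1 (f x)) //=.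
congr (_ + _).+1.
by apply: eq_bigr => j; rewrite eq_sym => /negPf ->.
Qed.

(** * Dividing for a permutation group with finitely many orbits on tuples *)

Section Orbits.

Variables (M : eqType) (G : (M -> M) -> Prop).
Hypothesis G_id : G id.
Hypothesis G_comp : forall f g, G f -> G g -> G (f \o g).
Hypothesis G_inv : forall f, G f -> exists2 g, G g & cancel f g /\ cancel g f.

(** Two slots, so that [conj2 A c A c'] says that c and c' have the same type over A. *)
Definition conj2 (c b c' b' : seq M) : Prop :=
  exists g, [/\ G g, map g c = c' & map g b = b'].

Lemma conj2_refl c b : conj2 c b c b.
Proof. by exists id; rewrite !map_id. Qed.

Lemma conj2_trans c b c1 b1 c2 b2 :
  conj2 c b c1 b1 -> conj2 c1 b1 c2 b2 -> conj2 c b c2 b2.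
Proof.
move=> [g [Gg <- <-]] [h [Gh <- <-]]; exists (h \o g).
by rewrite -!map_comp; split=> //; exact: G_comp.
Qed.

Lemma conj2_sym c b c1 b1 : conj2 c b c1 b1 -> conj2 c1 b1 c b.
Proof.
move=> [g [Gg <- <-]]; have [h Gh [gh _]] := G_inv Gg.
by exists h; rewrite !(mapK gh).
Qed.

Lemma conj2_map g c b : G g -> conj2 c b (map g c) (map g b).
Proof. by exists g. Qed.

Lemma conj2_swap c b c1 b1 : conj2 c b c1 b1 -> conj2 b c b1 c1.
Proof. by move=> [g [? ? ?]]; exists g. Qed.

(** Oligomorphy of the group. Equal colours force conjugacy, but colours may be finer than orbits,
    so a diagram can serve as colour. *)
Hypothesis finite_orbits : forall n, exists P (col : seq M -> 'I_P),
  forall s t, size s = n -> size t = n -> col s = col t -> conj2 [::] s [::] t.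

(** * Compactness from finitely many orbits *)

Lemma finite_orbits_over A n : exists P (col : seq M -> 'I_P),
  forall s t, size s = n -> size t = n -> col s = col t -> conj2 A s A t.
Proof.
have [P [col colP]] := finite_orbits (size A + n).
exists P, (fun s => col (A ++ s)) => s t ss st /colP[];
  rewrite ?size_cat ?ss ?st //.
move=> g [Gg _]; rewrite map_cat => /cat_inj[|? ?]; first by rewrite size_map.
by exists g.
Qed.

Lemma uniform_bound A n (X : seq M -> Prop) (Q : seq M -> nat -> Prop) :
  (forall s, X s -> size s = n) ->
  (forall s k l, k <= l -> Q s k -> Q s l) ->
  (forall s t k, X s -> X t -> conj2 A s A t -> Q s k -> Q t k) ->
  (forall s, X s -> exists k, Q s k) -> exists k, forall s, X s -> Q s k.
Proof.
move=> Xn Qmono Qinv QX; have [P [col colP]] := finite_orbits_over A n.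
have [||k kP] := @bounded_choice P (fun j k => forall s, X s -> col s = j -> Q s k).
- by move=> j l m lm Ql s Xs sj; apply: Qmono lm _; apply: Ql.
- move=> j; have [[s [Xs sj]]|nX] := pselect (exists s, X s /\ col s = j).
    have [k Qk] := QX _ Xs; exists k => t Xt tj; apply: Qinv Qk => //.
    by apply: colP; rewrite ?Xn // sj.
  by exists 0 => s Xs sj; case: nX; exists s.
- by exists k => s Xs; apply: kP.
Qed.

Lemma unbounded_orbit A n (f : nat -> seq M) : (forall i, size (f i) = n) ->
  exists i, forall l, exists I : seq nat,
    [/\ uniq I, size I = l & forall j, j \in I -> conj2 A (f i) A (f j)].
Proof.
move=> fn; have [P [col colP]] := finite_orbits_over A n.
pose Q j l := exists I : seq nat,
  [/\ uniq I, size I = l & forall i, i \in I -> col (f i) = j].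
have [||j Qj] := @unbounded_color P Q.
- move=> j m l ml [I [uI sI cI]]; exists (take m I).
  split; rewrite ?take_uniq ?size_takel ?sI // => i /mem_take.
  exact: cI.
- move=> l; pose s := iota 0 (P * l).
  have [[j jl]|nj] := pselect (exists j, l <= size [seq i <- s | col (f i) == j]).
    exists j, (take l [seq i <- s | col (f i) == j]); split.
    + by rewrite take_uniq // filter_uniq // iota_uniq.
    + by rewrite size_takel.
    + by move=> i /mem_take; rewrite mem_filter => /andP[/eqP].
  case: l @s nj => [|l] s nj.
    by exists (col (f 0)), [::].
  have : P * l.+1 <= P * l.
    rewrite -[X in X <= _](size_iota 0) -/s (size_filter_color (col \o f)).
    have -> : P * l = \sum_(j < P) l by rewrite sum_nat_const card_ord.
    apply: leq_sum => j _; rewrite -ltnS ltnNge; apply/negP => h.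
    by apply: nj; exists j.
  rewrite leq_mul2l ltnn orbF => /eqP P0.
  by have := ltn_ord (col (f 0)); rewrite [X in _ < X]P0.
- have [[|i [|? ?]] [] // _ _ iP] := Qj 1.
  exists i => l; have [I [uI sI cI]] := Qj l; exists I; split=> // i' i'I.
  by apply: colP; rewrite ?fn // (cI _ i'I) iP ?mem_head.
Qed.

(** Compactness. The tree of sequences satisfying [P] may branch infinitely, but only finitely up to
    conjugacy over A and the entries already chosen, so a sequence with arbitrarily long
    continuations can be prolonged to another one. *)
Lemma konig A n (P : seq (seq M) -> Prop) :
  (forall bs b, P bs -> b \in bs -> size b = n) ->
  (forall g bs, G g -> map g A = A -> P bs -> P (map (map g) bs)) ->
  (forall bs cs, P (bs ++ cs) -> P bs) ->
  (forall l, exists2 bs, size bs = l & P bs) ->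
  exists s : nat -> seq M, forall l, P (mkseq s l).
Proof.
move=> Pn Pinv Ppre Pl.
pose good bs := forall l, exists2 cs, size cs = l & P (bs ++ cs).
have ext bs : good bs -> exists b, good (rcons bs b).
  move=> /(_ _.+1) gbs.
  have /choice[f fP] l : exists b, exists2 cs, size cs = l & P (bs ++ b :: cs).
    by have [[|b cs] // [scs] Pcs] := gbs l; exists b, cs.
  have sf l : size (f l) = n.
    by have [cs _ /Pn] := fP l; apply; rewrite mem_cat mem_head orbT.
  have [i iP] := unbounded_orbit (A ++ flatten bs) sf.
  exists (f i) => l.
  have [I [uI sI /(_ _ _)IP]] := iP l.+1.
  have [j jI lj] : exists2 j, j \in I & l <= j.
    apply: contrapT => nj.
    have /(uniq_leq_size uI) : {subset I <= iota 0 l}.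
      move=> j jI; rewrite mem_iota /= add0n ltnNge; apply/negP => lj.
      by apply: nj; exists j.
    by rewrite sI size_iota ltnn.
  have [cs scs Pcs] := fP j.
  (* The long continuation through [f j] is moved, over A and [bs], to one through [f i]. *)
  have /conj2_sym[g [Gg gA gf]] := IP j jI.
  exists (take l (map (map g) cs)); first by rewrite size_takel // size_map scs.
  apply: (@Ppre _ (drop l (map (map g) cs))).
  rewrite -catA cat_take_drop cat_rcons.
  have := Pinv g _ Gg _ Pcs; rewrite map_cat /= gf.
  have gbs' : map (map g) bs = bs.
    rewrite -[RHS]map_id; apply/eq_in_map => b bbs; apply: map_id_sub gA => x xb.
    by rewrite mem_cat; apply/orP; right; apply/flattenP; exists b.
  rewrite gbs'; apply; apply: map_id_sub gA => x xA; by rewrite mem_cat xA.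
have /choice[nxt nxtP] bs : exists b, good bs -> good (rcons bs b).
  by have [/ext[b ?]|?] := pselect (good bs); [exists b|exists [::]].
pose fix st l := if l is l'.+1 then rcons (st l') (nxt (st l')) else [::].
have gst l : good (st l).
  elim: l => [|l IH]; last exact: nxtP.
  by move=> l; have [bs] := Pl l; exists bs.
exists (fun l => nxt (st l)) => l.
suff -> : mkseq (fun l => nxt (st l)) l = st l.
  by have [cs _ /Ppre] := gst l 0.
by elim: l => //= l IH; rewrite mkseqS IH.
Qed.

(** * Dividing and independence *)

(** The orbit of (c, b) stands for the dividing formula, and [c'] would be a common solution of its
    instances at the copies of b. [J] restricts the indices, for finite approximations of a
    witness. *)
Definition inconsistent k (J : pred nat) (c b : seq M) (g : nat -> M -> M) :=
  forall I : seq nat, uniq I -> size I = k -> all J I ->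
    ~ exists c', forall i, i \in I -> conj2 c b c' (map (g i) b).

(* [kdiv k A c b] says that [tp(c/b)] [k]-divides over [A]; in [div], [b] is
   completed to [Ab] to give the usual [tp(c/Ab)]. *)
Definition kdiv k (A c b : seq M) : Prop :=
  exists g : nat -> M -> M,
    (forall i, G (g i) /\ map (g i) A = A) /\ inconsistent k predT c b g.

Definition div A c b : Prop := exists k, kdiv k A c (A ++ b).

Lemma kdiv_mono k A c b A' b' :
  {subset A <= A'} -> {subset b <= b'} -> kdiv k A' c b -> kdiv k A c b'.
Proof.
move=> AA' bb' [g [gA gI]]; exists g; split=> [i|I uI sI aI [c' c'P]].
  by have [Gg /(map_id_sub AA')] := gA i.
apply: (gI I uI sI aI); exists c' => i /c'P[h [Gh hc /(map_sub bb') hb]].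
by exists h.
Qed.

Lemma kdiv_leq k l A c b : k <= l -> kdiv k A c b -> kdiv l A c b.
Proof.
move=> kl [g [gA gI]]; exists g; split=> // I uI sI _ [c' c'P].
apply: (gI (take k I)); rewrite ?take_uniq ?size_takel ?sI ?all_predT //.
by exists c' => i /mem_take /c'P.
Qed.

Lemma kdiv_map k g A c b :
  G g -> kdiv k A c b -> kdiv k (map g A) (map g c) (map g b).
Proof.
move=> Gg [f [fA fI]]; have [h Gh [gh hg]] := G_inv Gg.
exists (fun i => g \o f i \o h); split=> [i|I uI sI aI [c' c'P]].
  have [Gf fiA] := fA i; split; first by apply: (G_comp (G_comp _ _)).
  by rewrite (map_comp _ h) (map_comp g) (mapK gh) fiA.
apply: (fI I uI sI aI); exists (map h c') => i /c'P[u [Gu <- ub]].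
exists (h \o u \o g); split; first by apply: (G_comp (G_comp _ _)).
  by rewrite (map_comp _ g) (map_comp h u).
by rewrite (map_comp _ g) (map_comp h u) ub (map_comp _ h) (map_comp g) !(mapK gh).
Qed.

(** k-inconsistency concerns finitely many indices at a time and is invariant over A, so [konig]
    yields one infinite witness. *)
Lemma kdiv_fin k A c b :
  (forall l, exists g : nat -> M -> M,
     (forall i, G (g i) /\ map (g i) A = A) /\
     inconsistent k (fun i => i < l) c b g) -> kdiv k A c b.
Proof.
move=> H; pose P bs := (forall b', b' \in bs -> conj2 A b A b') /\
  forall I : seq nat, uniq I -> size I = k -> all (fun i => i < size bs) I ->
    ~ exists c', forall i, i \in I -> conj2 c b c' (nth [::] bs i).
have [||||s sP] := @konig A (size b) P.
- by move=> bs b' [bP _] /bP[g [_ _ <-]]; rewrite size_map.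
- move=> g bs Gg gA [bP PI]; split=> [b' /mapP[b1 /bP b1P ->]|I uI sI].
    by apply: conj2_trans b1P _; exists g.
  rewrite size_map => aI [c' c'P]; apply: (PI I uI sI aI).
  have [h Gh [gh hg]] := G_inv Gg; exists (map h c') => i iI.
  have [u [Gu uc]] := c'P _ iI; rewrite (nth_map [::]); last exact: (allP aI).
  move=> ub; exists (h \o u); rewrite !(map_comp h u) uc ub (mapK gh).
  by split=> //; exact: G_comp.
- move=> bs cs [bP PI]; split=> [b' bb'|I uI sI aI [c' c'P]].
    by apply: bP; rewrite mem_cat bb'.
  apply: (PI I uI sI).
    apply: sub_all aI => i ib; rewrite size_cat; exact: ltn_addr.
  exists c' => i iI; rewrite nth_cat; have /= -> := allP aI _ iI; exact: c'P.
- move=> l; have [g [gA gI]] := H l.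
  exists (mkseq (fun i => map (g i) b) l); first by rewrite size_mkseq.
  split=> [b' /mapP[i _ ->]|I uI sI].
    by have [? ?] := gA i; exists (g i).
  rewrite size_mkseq => aI [c' c'P]; apply: (gI I uI sI aI).
  exists c' => i iI; have /= il := allP aI _ iI.
  by have := c'P _ iI; rewrite nth_mkseq.
have /choice[g gP] i : exists g, [/\ G g, map g A = A & map g b = s i].
  have [/(_ (s i)) + _] := sP i.+1; rewrite mkseqS mem_rcons mem_head.
  by move=> /(_ isT).
exists g; split=> [i|I uI sI _ [c' c'P]]; first by have [] := gP i.
have maxI j : j \in I -> j < (\max_(i <- I) i).+1.
  by move=> jI; rewrite ltnS; apply: (@leq_bigmax_seq _ I xpredT (fun i => i)).
have [_ /(_ I uI sI)] := sP (\max_(i <- I) i).+1; case.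
  by rewrite size_mkseq; apply/allP.
exists c' => i iI; rewrite nth_mkseq; last exact: maxI.
by have [_ _ <-] := gP i; exact: c'P.
Qed.

(* [e] independent from [a] over [A] lets a sequence witnessing that
   [tp(c/Aa)] divides over [A] be conjugated so as to be over [Ae]. *)
Lemma kdiv_indep k A c a e :
  kdiv k A c (A ++ a) -> ~ div A e a -> kdiv k (A ++ e) c (A ++ a).
Proof.
move=> [g [gA gI]] nd; apply: kdiv_fin => l.
(* As tp(e/Aa) does not l-divide along [g], some l copies of Aa admit a common conjugate [e'] of e.
   The inverse [u] of the automorphism for the first of them returns e' to e, and so turns these
   copies into conjugates of Aa over Ae. *)
have [I [uI sI [e' e'P]]] : exists I, [/\ uniq I, size I = l & exists e',
    forall i, i \in I -> conj2 e (A ++ a) e' (map (g i) (A ++ a))].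
  apply: contrapT => nI; apply: nd; exists l, g; split=> // I uI sI _ eI.
  by apply: nI; exists I.
case: l sI => [|l] sI.
  exists (fun=> id); split=> [i|[|//] uJ sJ aJ]; first by rewrite map_id.
  move=> _; apply: (gI [::]) => //; by exists c.
have /e'P[h [Gh he]] : nth 0 I 0 \in I by rewrite mem_nth ?sI.
have [_ gA0] := gA (nth 0 I 0).
rewrite !map_cat gA0 => /cat_inj[|hA _]; first by rewrite size_map.
have [u Gu [hu uh]] := G_inv Gh.
have uA : map u A = A by rewrite -[in LHS]hA (mapK hu).
have ue : map u e' = e by rewrite -he (mapK hu).
have /choice[f fP] j : exists f, [/\ G f, map f (A ++ e) = A ++ e &
    j < l.+1 -> map f (A ++ a) = map u (map (g (nth 0 I j)) (A ++ a))].
  case: (ltnP j l.+1) => [jl|_]; last by exists id; rewrite map_id.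
  have [f [Gf fe fa]] := e'P _ (mem_nth 0 (leq_trans jl (eq_leq (esym sI)))).
  exists (u \o f); split=> [||_]; first exact: G_comp.
    rewrite (map_comp u f) !map_cat fe ue; congr (_ ++ _).
    have [_ gAj] := gA (nth 0 I j).
    move: fa; rewrite !map_cat gAj => /cat_inj[|-> _ //]; by rewrite size_map.
  by rewrite (map_comp u f) fa.
exists f; split=> [j|J uJ sJ aJ [c' c'P]]; first by have [] := fP j.
apply: (gI (map (nth 0 I) J)); rewrite ?size_map ?all_predT //.
  rewrite map_inj_in_uniq // => i j /(allP aJ)/= il /(allP aJ)/= jl /eqP.
  by rewrite nth_uniq ?sI // => /eqP.
exists (map h c') => _ /mapP[j jJ ->]; have [v [Gv <- vb]] := c'P _ jJ.
exists (h \o v); split; [exact: G_comp|by rewrite (map_comp h v)|].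
have [_ _ fa] := fP j; rewrite (map_comp h v) vb fa; last exact: (allP aJ).
by rewrite (mapK uh).
Qed.

(** If tp(e'e/Aa) divided, [kdiv_indep] would give a witness fixing e, and its copies of Aae would
    show that tp(e'/Aae) divides over A. *)
Lemma indep_trans A a e e' :
  ~ div A e a -> ~ div A e' (a ++ e) -> ~ div A (e' ++ e) a.
Proof.
move=> nea ne' [k /kdiv_indep /(_ nea)[g [gAe gI]]]; apply: ne'; exists k.
exists g; split=> [i|I uI sI aI [c' c'P]].
  by have [? ] := gAe i; rewrite map_cat => /cat_inj[|? _]; rewrite ?size_map.
apply: (gI I uI sI aI); exists (c' ++ e) => i /c'P[h [Gh hc hb]]; exists h.
have [_ gie] := gAe i.
have {}gie : map (g i) e = e.
  by apply: map_id_sub gie => x; rewrite mem_cat orbC => ->.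
split=> //.
  rewrite map_cat hc -[in RHS]gie; congr (_ ++ _); apply: (map_sub _ hb) => x.
  by rewrite !mem_cat => ->; rewrite !orbT.
apply: (map_sub _ hb) => x; rewrite !mem_cat => /orP[] ->; rewrite ?orbT //.
Qed.

Lemma indep_sub A c b b' : {subset b <= A ++ b'} -> ~ div A c b' -> ~ div A c b.
Proof.
move=> bb' nd [k d]; apply: nd; exists k; apply: kdiv_mono d => // x.
by rewrite mem_cat => /orP[xA|/bb' //]; rewrite mem_cat xA.
Qed.

Lemma indep_nil A b : ~ div A [::] b.
Proof.
move=> [k [g [gA /(_ (iota 0 k))]]]; rewrite iota_uniq size_iota all_predT.
case=> //; exists [::] => i _; have [Gg _] := gA i; by exists (g i).
Qed.

Lemma div_map g A c b : G g -> div A c b -> div (map g A) (map g c) (map g b).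
Proof. by move=> Gg [k d]; exists k; rewrite -map_cat; apply: kdiv_map. Qed.

(* The head of the list is its last member in the usual enumeration of an
   independent sequence. *)
Fixpoint indep A (l : seq (seq M)) : Prop :=
  if l is a :: l' then ~ div A a (flatten l') /\ indep A l' else True.

Lemma indep_map g A l : G g -> map g A = A -> indep A l ->
  indep A (map (map g) l).
Proof.
move=> Gg gA; elim: l => //= a l IH [nd /IH il]; split=> // d; apply: nd.
have [h Gh [gh hg]] := G_inv Gg; move: (div_map Gh d); rewrite (mapK gh).
by rewrite -map_flatten -[in map h A]gA !(mapK gh).
Qed.

Lemma indep_filter A p l : indep A l -> indep A (filter p l).
Proof.
elim: l => //= a l IH [nd /IH il]; case: ifP => //= _; split=> //.
apply: indep_sub nd => x /flattenP[b]; rewrite mem_filter => /andP[_ bl] xb.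
by rewrite mem_cat; apply/orP; right; apply/flattenP; exists b.
Qed.

(** Obtained from [indep_trans] before symmetry is available: the later members, which stand first
    in the list, are jointly independent from the earlier [a]. *)
Lemma indep_before A l1 a l2 : indep A (l1 ++ a :: l2) -> ~ div A (flatten l1) a.
Proof.
elim: l1 => [_|b l1 IH /= [nd /IH il]]; first exact: indep_nil.
apply: indep_trans il _; apply: indep_sub nd => x.
by rewrite flatten_cat !mem_cat => /orP[] ->; rewrite ?orbT.
Qed.

(** * Dividing chains and trees *)

Fixpoint chain k A c (bs : seq (seq M)) : Prop :=
  if bs is b :: bs' then kdiv k A c b /\ chain k (A ++ b) c bs' else True.

Lemma chain_base k A A' c bs :
  {subset A <= A'} -> chain k A' c bs -> chain k A c bs.
Proof.
elim: bs A A' => //= b bs IH A A' AA' [d ch]; split; first exact: kdiv_mono d.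
by apply: IH ch => x; rewrite !mem_cat => /orP[/AA'|] ->; rewrite ?orbT.
Qed.

Lemma chain_map k g A c bs :
  G g -> chain k A c bs -> chain k (map g A) (map g c) (map (map g) bs).
Proof.
move=> Gg; elim: bs A => //= b bs IH A [d ch].
by rewrite -map_cat; split; [apply: kdiv_map|apply: IH].
Qed.

Lemma chain_filter k A c p bs : chain k A c bs -> chain k A c (filter p bs).
Proof.
elim: bs A => //= b bs IH A [d ch]; case: ifP => _ /=; first by split; auto.
by apply: IH; apply: chain_base ch => x; rewrite mem_cat => ->.
Qed.

Lemma chain_catl k A c bs cs : chain k A c (bs ++ cs) -> chain k A c bs.
Proof. by elim: bs A => //= b bs IH A [d /IH]. Qed.

Lemma chain_mid k A c bs b cs :
  chain k A c (bs ++ b :: cs) -> kdiv k (A ++ flatten bs) c b.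
Proof.
elim: bs A => /= [A [d _]|b' bs IH A [_ /IH]]; first by rewrite cats0.
by rewrite catA.
Qed.

(** The witness of the first step contains arbitrarily many copies of [b] in one orbit over AB.
    Moving [b] into that orbit and keeping only such copies makes the step divide over AB, by
    [kdiv_fin]; induction handles the rest of the chain over the moved [b]. *)
Lemma chain_extend k A c bs B : chain k A c bs ->
  exists g, [/\ G g, map g A = A & chain k (A ++ B) (map g c) (map (map g) bs)].
Proof.
move: {2}(size bs) (erefl (size bs)) => n.
elim: n bs A c => [|n IH] [|b bs] A c //=; first by exists id; rewrite map_id.
move=> [sbs] [[g [gA gI]] ch].
have [|i iP] := @unbounded_orbit (A ++ B) (size b) (fun i => map (g i) b).
  by move=> i; rewrite size_map.
have [Gg giA] := gA i.
have [h [Gh hAb {}ch]] := IH _ _ _ (etrans (size_map _ _) sbs) (chain_map Gg ch).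
move: hAb; rewrite map_cat giA => hAb.
have hA : map h A = A by apply: map_id_sub hAb => x; rewrite mem_cat => ->.
have hb : map h (map (g i) b) = map (g i) b.
  by apply: map_id_sub hAb => x; rewrite mem_cat orbC => ->.
exists (h \o g i); split; [exact: G_comp|by rewrite (map_comp h (g i)) giA|].
have bsE : map (map (h \o g i)) bs = map (map h) (map (map (g i)) bs).
  by rewrite -(map_comp (map h)); apply: eq_map => s; exact: map_comp.
rewrite /= bsE !(map_comp h (g i)) hb; split; last first.
  by apply: chain_base ch => x; rewrite map_cat giA !mem_cat orbAC.
apply: kdiv_fin => l; have [I [uI sI IP]] := iP l.
have /choice[f fP] j : exists f, [/\ G f, map f (A ++ B) = A ++ B &
    j < l -> map f (map (g i) b) = map (g (nth 0 I j)) b].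
  case: (ltnP j l) => [jl|_]; last by exists id; rewrite map_id.
  have [f [Gf fA fb]] := IP _ (mem_nth 0 (leq_trans jl (eq_leq (esym sI)))).
  by exists f.
exists f; split=> [j|J uJ sJ aJ [c' c'P]]; first by have [] := fP j.
apply: (gI (map (nth 0 I) J)); rewrite ?size_map ?all_predT //.
  rewrite map_inj_in_uniq // => j1 j2 /(allP aJ)/= il /(allP aJ)/= jl /eqP.
  by rewrite nth_uniq ?sI // => /eqP.
exists c' => _ /mapP[j jJ ->]; have [v [Gv <- vb]] := c'P _ jJ.
exists (v \o h \o g i); split; first by apply: (G_comp (G_comp _ _)).
  by rewrite (map_comp _ (g i)) (map_comp v h).
have [_ _ fb] := fP j; rewrite (map_comp _ (g i)) (map_comp v h) hb vb fb //.
exact: (allP aJ).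
Qed.

(* Conjugating an infinite dividing chain along its own witnesses spreads it
   into a tree. *)
Lemma dividing_tree k c b :
  (forall n, exists c' bs, [/\ size bs = n, chain k [::] c' bs &
     forall b', b' \in bs -> conj2 c b c' b']) ->
  exists a : seq nat -> seq M,
    (forall s I, uniq I -> size I = k ->
       ~ exists c', forall i, i \in I -> conj2 c b c' (a (rcons s i))) /\
    (forall (sigma : nat -> nat) l,
       exists c', forall j, j < l -> conj2 c b c' (a (mkseq sigma j))).
Proof.
move=> H; pose P bs := exists c', chain k [::] c' bs /\
  forall b', b' \in bs -> conj2 c b c' b'.
have [||||s sP] := @konig [::] (size b) P.
- by move=> bs b' [c' [_ /[apply]]] [g [_ _ <-]]; rewrite size_map.
- move=> g bs Gg _ [c' [ch bP]]; exists (map g c'); split.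
    exact: (chain_map Gg ch).
  by move=> _ /mapP[b' /bP b'P ->]; apply: conj2_trans b'P _; exact: conj2_map.
- move=> bs cs [c' [/chain_catl ch bP]]; exists c'; split=> // b' bb'.
  by apply: bP; rewrite mem_cat bb'.
- by move=> l; have [c' [bs [? ? ?]]] := H l; exists bs => //; exists c'.
have /choice[h hP] j : exists h : nat -> M -> M,
    (forall i, G (h i) /\ map (h i) (flatten (mkseq s j.+1)) =
                          flatten (mkseq s j.+1)) /\
    (forall I, uniq I -> size I = k -> ~ exists c', forall i, i \in I ->
       conj2 c b c' (map (h i) (s j.+1))).
  have [c' [ch bP]] := sP j.+2.
  move: ch; rewrite mkseqS -cats1 => /chain_mid /= [h [hA hI]].
  exists h; split=> // I uI sI [d dP]; apply: (hI I uI sI); rewrite ?all_predT //.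
  exists d => i /dP; apply: conj2_trans; apply: conj2_sym; apply: bP.
  by rewrite mkseqS mem_rcons mem_head.
(* The node [t] receives [s (size t)] moved by [gs 0 t]. Since [h j] fixes s_0, ..., s_j and spreads
   out s_(j+1), prolonging [t] leaves the earlier nodes in place, and every finite branch is
   conjugate to an initial part of [s]. *)
pose fix gs j t : M -> M := if t is i :: t' then h j i \o gs j.+1 t' else id.
have Ggs j t : G (gs j t).
  by elim: t j => //= i t IH j; apply: G_comp => //; case: (hP j) => /(_ i)[].
have gs_rcons t i : gs 0 (rcons t i) = gs 0 t \o h (size t) i.
  rewrite -[size t]add0n; elim: t 0 => [|i' t IH] j /=; first by rewrite addn0.
  by rewrite IH addnS.
exists (fun t => map (gs 0 t) (s (size t))); split=> [t I uI sI [d dP]|sigma l].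
  have [u Gu [gu ug]] := G_inv (Ggs 0 t).
  have [_ /(_ I uI sI)] := hP (size t); apply; exists (map u d) => i /dP.
  rewrite gs_rcons size_rcons (map_comp (gs 0 t)) => /conj2_trans; apply.
  by exists u; rewrite (mapK gu).
have [c' [_ bP]] := sP l; exists (map (gs 0 (mkseq sigma l)) c') => j jl.
rewrite size_mkseq.
have /conj2_trans : conj2 c b c' (s j).
  by apply: bP; apply/mapP; exists j; rewrite ?mem_iota.
apply; exists (gs 0 (mkseq sigma l)); split=> //.
rewrite -(subnKC (ltnW jl)); elim: (l - j) => [|i IH]; first by rewrite addn0.
rewrite addnS mkseqS gs_rcons size_mkseq (map_comp (gs 0 _)) -[RHS]IH.
congr (map _ _); have [/(_ (sigma (j + i)))[_ hA] _] := hP (j + i).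
apply: map_id_sub hA => x xs; apply/flattenP; exists (s j) => //.
by apply/mapP; exists j; rewrite ?mem_iota // ltnS leq_addr.
Qed.

(** * Kim's lemma, existence, extension and symmetry *)

(** The form in which simplicity is used: by [dividing_tree], unbounded chains in one orbit would
    give the tree property. *)
Hypothesis chain_bounded : forall k c b, exists N, forall c' bs,
  chain k [::] c' bs -> (forall b', b' \in bs -> conj2 c b c' b') -> size bs <= N.

(** Deleting members leaves a chain, because dividing passes to smaller bases. So the chain is
    sorted by the orbits of (c, b) and the finitely many bounds are added. *)
Lemma chain_size k d m : exists N, forall A c bs, size c = d ->
  (forall b, b \in bs -> size b = m) -> chain k A c bs -> size bs <= N.
Proof.
have [P [col colP]] := finite_orbits (d + m).
have [||n nP] := @bounded_choice P (fun j n => forall c bs, size c = d ->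
  (forall b, b \in bs -> size b = m /\ col (c ++ b) = j) ->
  chain k [::] c bs -> size bs <= n).
- by move=> j n n' nn' nP c bs sc sbs ch; apply: leq_trans nn'; apply: nP ch.
- move=> j; have [[[c b] [/= sc sb cb]]|nj] :=
      pselect (exists p, [/\ size p.1 = d, size p.2 = m & col (p.1 ++ p.2) = j]).
    have [N NP] := chain_bounded k c b; exists N => c' bs sc' bsP ch.
    apply: NP ch _ => b' /bsP[sb' cb'].
    have [|||g [Gg _]] := colP (c ++ b) (c' ++ b').
    + by rewrite size_cat sc sb.
    + by rewrite size_cat sc' sb'.
    + by rewrite cb.
    + rewrite map_cat => /cat_inj[|? ?]; first by rewrite size_map sc.
      by exists g.
  exists 0 => c [|b bs] // sc /(_ b (mem_head _ _))[sb cb] _.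
  by case: nj; exists (c, b).
exists (\sum_(j < P) n) => A c bs sc sbs ch.
rewrite (size_filter_color (fun b => col (c ++ b))); apply: leq_sum => j _.
apply: (nP j c) => // [b|].
  by rewrite mem_filter => /andP[/eqP-> /sbs].
by apply: chain_filter; apply: chain_base ch.
Qed.

(** The chain runs backwards through the sequence: by [indep_before] the later members are
    independent from [a], so [kdiv_indep] raises the base of the dividing at [a] from A to include
    them. *)
Lemma indep_chain k A B c l1 l2 : {subset B <= A ++ flatten l1} ->
  indep A (l1 ++ l2) -> (forall a, a \in l2 -> kdiv k A c (A ++ a)) ->
  chain k B c (map (cat A) l2).
Proof.
elim: l2 l1 B => //= a l2 IH l1 B Bl1 il dl2; split.
  apply: (@kdiv_mono k B c (A ++ a) (A ++ flatten l1)) => //.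
  by apply: kdiv_indep (indep_before il); apply: dl2; rewrite mem_head.
apply: (IH (rcons l1 a)); last by move=> b bl; apply: dl2; rewrite inE bl orbT.
  move=> x; rewrite -cats1 flatten_cat /= cats0 !mem_cat.
  move=> /orP[/Bl1|/orP[|]]; rewrite ?mem_cat.
  - by case/orP=> ->; rewrite ?orbT.
  - by move=> ->; rewrite ?orbT.
  - by move=> ->; rewrite ?orbT.
by rewrite cat_rcons.
Qed.

(** Kim's lemma in bounded form: an independent sequence at whose members the type of [c] k-divides
    is itself a dividing chain. *)
Lemma kim A k d m : exists N, forall c l, size c = d -> indep A l ->
  (forall a, a \in l -> size a = m /\ kdiv k A c (A ++ a)) -> size l <= N.
Proof.
have [N NP] := chain_size k d (size A + m); exists N => c l sc il lP.
rewrite -(size_map (cat A)); apply: (NP A c) => //.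
  by move=> _ /mapP[a /lP[sa _] ->]; rewrite size_cat sa.
by apply: (@indep_chain _ _ _ _ [::]) => // [x|a /lP[]//]; rewrite cats0.
Qed.

Lemma div_uniform A (c : seq M) B (X : seq M -> Prop) :
  (forall c', X c' -> size c' = size c /\ div A c' B) ->
  exists k, forall c', X c' -> kdiv k A c' (A ++ B).
Proof.
move=> XP; apply: (@uniform_bound (A ++ B) (size c)).
- by move=> s /XP[].
- by move=> s k l kl; exact: kdiv_leq.
- move=> s t k _ _ [g [Gg gAB <-]] /(kdiv_map Gg); rewrite gAB.
  by rewrite (map_id_sub _ gAB) // => x; rewrite mem_cat => ->.
- by move=> s /XP[].
Qed.

(** Otherwise all conjugates of [c] over A divide with one k. Then any chain can be moved over AB by
    [chain_extend] and lengthened by AB in front, against [chain_size]. *)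
Lemma indep_exists A c B :
  exists g, [/\ G g, map g A = A & ~ div A (map g c) B].
Proof.
apply: contrapT => nE.
have [c' [g [Gg gA <-]]|k kP] := @div_uniform A c B (fun c' => conj2 A c A c').
  rewrite size_map; split=> //; apply: contrapT => nd; apply: nE; by exists g.
have [N NP] := chain_size k (size c) (size A + size B).
have [c' [bs [sbs cc' ch bP]]] : exists c' bs, [/\ size bs = N.+1, conj2 A c A c',
    chain k A c' bs & forall b : seq M, b \in bs -> size b = size A + size B].
  elim: N.+1 => [|n [c' [bs [sbs cc' ch bP]]]].
    by exists c, [::]; split=> //; exact: conj2_refl.
  have [g [Gg gA ch']] := chain_extend (A ++ B) ch.
  have cgc' : conj2 A c A (map g c') by apply: conj2_trans cc' _; exists g.
  exists (map g c'), ((A ++ B) :: map (map g) bs); split=> //=.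
  - by rewrite size_map sbs.
  - by split=> //; exact: kP.
  - move=> b; rewrite inE => /orP[/eqP->|/mapP[b' /bP sb' ->]].
      by rewrite size_cat.
    by rewrite size_map.
suff : size bs <= N by rewrite sbs ltnn.
apply: NP bP ch; by case: cc' => g [_ _ <-]; rewrite size_map.
Qed.

(** Every subfamily must be independent, because a dividing witness made of these conjugates is
    tested on arbitrary sets of indices. The reversal puts the latest conjugate at the head. *)
Lemma indep_conjugates A c l : exists g : nat -> M -> M,
  (forall i, G (g i) /\ map (g i) A = A) /\
  forall p, indep A [seq map (g i) c | i <- rev (iota 0 l) & p i].
Proof.
elim: l => [|l [g [gA ig]]].
  by exists (fun=> id); split=> // i; rewrite map_id.
have [h [Gh hA hd]] :=
  indep_exists A c (flatten [seq map (g i) c | i <- rev (iota 0 l)]).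
exists (fun i => if i == l then h else g i); split=> [i|].
  by case: eqP.
have E p : [seq map (if i == l then h else g i) c | i <- rev (iota 0 l) & p i] =
    [seq map (g i) c | i <- rev (iota 0 l) & p i].
  apply/eq_in_map => i; rewrite mem_filter mem_rev mem_iota /= add0n.
  by move=> /andP[_ /ltn_eqF ->].
move=> p; rewrite -addn1 iotaD rev_cat /= add0n.
case: ifP => _ /=; rewrite E // eqxx; split=> //.
apply: indep_sub hd => x /flattenP[b /mapP[i]].
rewrite mem_filter => /andP[_ il] -> xb.
rewrite mem_cat; apply/orP; right; apply/flattenP; exists (map (g i) c) => //.
exact: map_f.
Qed.

(** If all conjugates of [c] over Ab divided with bB, then by [kim] no conjugate of [c] could serve
    N+1 independent copies of bB at once, so these copies would witness that tp(c/Ab) already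
    divides. *)
Lemma indep_extend A c b B : ~ div A c b ->
  exists g, [/\ G g, map g (A ++ b) = A ++ b & ~ div A (map g c) (b ++ B)].
Proof.
move=> nd; apply: contrapT => nE.
have [c' [g [Gg gA <-]]|k kP] :=
    @div_uniform A c (b ++ B) (fun c' => conj2 (A ++ b) c (A ++ b) c').
  rewrite size_map; split=> //; apply: contrapT => nd'; apply: nE; by exists g.
have [N NP] := kim A k (size c) (size b + size B).
apply: nd; exists N.+1; apply: kdiv_fin => l.
have [g [gA ig]] := indep_conjugates A (b ++ B) l.
exists g; split=> // I uI sI aI [c' c'P].
pose J := [seq i <- rev (iota 0 l) | i \in I].
have sJ : size J = N.+1.
  rewrite -sI; apply/perm_size/uniq_perm => [|//|i].
    by rewrite filter_uniq // rev_uniq iota_uniq.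
  rewrite mem_filter mem_rev mem_iota; case iI: (i \in I) => //=.
  exact: (allP aI).
have [i0 i0I] : exists i, i \in I.
  by case: (I) sI => // i I' _; exists i; rewrite mem_head.
suff : size [seq map (g i) (b ++ B) | i <- J] <= N.
  by rewrite size_map sJ ltnn.
apply: (NP c').
- by have [h [_ <- _]] := c'P _ i0I; rewrite size_map.
- exact: ig.
- move=> _ /mapP[i + ->]; rewrite mem_filter => /andP[iI _].
  rewrite size_map size_cat; split=> //.
  have [h [Gh hc hb]] := c'P _ iI; have [Gg gAi] := gA i.
  have [u Gu [gu ug]] := G_inv Gg.
  have /kP/(kdiv_map Gg) : conj2 (A ++ b) c (A ++ b) (map u c').
    exists (u \o h); rewrite (map_comp u h) hb (mapK gu) (map_comp u h) hc.
    by split=> //; exact: G_comp.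
  by rewrite (mapK ug) map_cat gAi.
Qed.

(** Extension yields arbitrarily long sequences in tp(a/Ab) that are independent over A. If tp(b/Aa)
    k-divided, so would tp(b/Aa') for every member a', against [kim]. *)
Lemma indep_sym A a b : ~ div A a b -> ~ div A b a.
Proof.
move=> nd [k d]; have [N NP] := kim A k (size b) (size a).
have [l [sl il lP]] : exists l, [/\ size l = N.+1, indep A l &
    forall a', a' \in l -> conj2 (A ++ b) a (A ++ b) a'].
  elim: N.+1 => [|n [l [sl il lP]]]; first by exists [::].
  have [g [Gg gAb gd]] := indep_extend (flatten l) nd.
  exists (map g a :: l); split=> /=; first by rewrite sl.
    split=> //; apply: indep_sub gd => x xl; by rewrite !mem_cat xl !orbT.
  by move=> a'; rewrite inE => /orP[/eqP->|/lP //]; exists g.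
suff : size l <= N by rewrite sl ltnn.
apply: (NP b) => // a' /lP[g [Gg]]; rewrite map_cat.
move=> /cat_inj[|gA gb ga]; first by rewrite size_map.
split; first by rewrite -ga size_map.
by have := kdiv_map Gg d; rewrite map_cat gA gb ga.
Qed.

(** * Independent sequences with one type of pairs *)

Fixpoint pairs (R : seq M -> seq M -> Prop) (l : seq (seq M)) : Prop :=
  if l is a :: l' then (forall b, b \in l' -> R a b) /\ pairs R l' else True.

Lemma pairs_filter (R : seq M -> seq M -> Prop) p l :
  pairs R l -> pairs R (filter p l).
Proof.
elim: l => //= a l IH [aR /IH lR]; case: ifP => //= _; split=> // b.
by rewrite mem_filter => /andP[_ /aR].
Qed.

Lemma pairs_impl (R R' : seq M -> seq M -> Prop) l :
  (forall a b, a \in l -> b \in l -> R a b -> R' a b) -> pairs R l -> pairs R' l.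
Proof.
elim: l => //= a l IH RR' [aR lR]; split=> [b bl|].
  by apply: RR'; rewrite ?mem_head ?inE ?bl ?orbT //; exact: aR.
by apply: IH lR => b c bl cl; apply: RR'; rewrite inE ?bl ?cl orbT.
Qed.

(* The top element [y] realises over [l] the type of every later element, so
   the type of a pair in [l] depends on the earlier element only. *)
Lemma indep_end_homogeneous A c n : exists y l, [/\ size l = n,
  indep A (y :: l), forall a, a \in y :: l -> conj2 A c A a &
  pairs (fun w z => conj2 w z y z) l].
Proof.
elim: n => [|n [y [l [sl il lP lR]]]].
  have [g [Gg gA gd]] := indep_exists A c [::].
  exists (map g c), [::]; split=> /= [//|//|a|//].
  by rewrite inE => /eqP->; exists g.
have /= [nd il'] := il; have [g [Gg gAl gd]] := indep_extend y nd.
have gA : map g A = A by apply: map_id_sub gAl => x; rewrite mem_cat => ->.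
have gl z : z \in l -> map g z = z.
  move=> zl; apply: map_id_sub gAl => x xz.
  by rewrite mem_cat; apply/orP; right; apply/flattenP; exists z.
exists (map g y), (y :: l); split=> /=; first by rewrite sl.
- split=> //; apply: indep_sub gd => x.
  by rewrite !mem_cat => /orP[] ->; rewrite !orbT.
- move=> a; rewrite inE => /orP[/eqP->|/lP //].
  by apply: conj2_trans (lP y (mem_head _ _)) _; exists g.
- split=> [z zl|]; first by exists g; rewrite (gl z).
  apply: pairs_impl lR => w z wl zl wz; apply: conj2_trans wz _.
  by exists g; rewrite (gl z).
Qed.

Lemma indep_drop A n l : indep A l -> indep A (drop n l).
Proof. by elim: l n => [|a l IH] [|n] //= [_ /IH]. Qed.

Lemma pairs_drop R n l : pairs R l -> pairs R (drop n l).
Proof. by elim: l n => [|a l IH] [|n] //= [_ /IH]. Qed.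

(** Stands for a Morley sequence in tp(c/A), given by finite pieces of every length. *)
Definition morley A c (r : seq M * seq M) : Prop := forall n, exists l,
  [/\ size l = n, indep A l, forall a, a \in l -> conj2 A c A a &
      pairs (fun w z => conj2 w z r.1 r.2) l].

(** In the sequences of [indep_end_homogeneous] the type of a pair depends on its earlier member
    only, so it is enough to colour single members by their pair with the top [y]. *)
Lemma morley_exists A c :
  exists r, [/\ size r.1 = size c, size r.2 = size c & morley A c r].
Proof.
have [P [col colP]] := finite_orbits (size c + size c).
have sz a : conj2 A c A a -> size a = size c.
  by move=> [g [_ _ <-]]; rewrite size_map.
pose Q j n := exists y l, [/\ n <= size l, indep A l,
  forall a, a \in y :: l -> conj2 A c A a, pairs (fun w z => conj2 w z y z) l &
  forall a, a \in l -> col (y ++ a) = j].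
have [||j Qj] := @unbounded_color P Q.
- move=> j m n mn [y [l [sl il lP lR lj]]]; exists y, l.
  by split=> //; apply: leq_trans sl.
- move=> n; have [y [l [sl [_ il] lP lR]]] := indep_end_homogeneous A c (P * n.+1).
  have [j jn] : exists j, n <= size [seq a <- l | col (y ++ a) == j].
    apply: contrapT => nj; have : P * n.+1 <= P * n.
      rewrite -[X in X <= _]sl (size_filter_color (fun a => col (y ++ a))).
      have -> : P * n = \sum_(j < P) n by rewrite sum_nat_const card_ord.
      apply: leq_sum => j _; rewrite ltnW // ltnNge; apply/negP => h.
      by apply: nj; exists j.
    rewrite leq_mul2l ltnn orbF => /eqP P0.
    by have := ltn_ord (col y); rewrite [X in _ < X]P0.
  exists j, y, [seq a <- l | col (y ++ a) == j]; split=> //.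
  + exact: indep_filter.
  + move=> a; rewrite inE mem_filter => /orP[/eqP->|/andP[_ al]].
      by apply: lP; rewrite mem_head.
    by apply: lP; rewrite inE al orbT.
  + exact: pairs_filter.
  + by move=> a; rewrite mem_filter => /andP[/eqP].
(* A sequence of length one supplies the representative r; the common colour carries it to all
   lengths. *)
have [y [[|z ?] [//= _ _ lP _ lj]]] := Qj 1.
have sy : size y = size c by apply: sz; apply: lP; rewrite mem_head.
have sz' : size z = size c by apply: sz; apply: lP; rewrite !inE eqxx orbT.
exists (y, z); split=> // n; have [y' [l [sl il lP' lR lj']]] := Qj n.
have dl a : a \in drop (size l - n) l -> a \in l by exact: mem_drop.
exists (drop (size l - n) l); split.
- by rewrite size_drop subKn.
- exact: indep_drop.
- by move=> a /dl al; apply: lP'; rewrite inE al orbT.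
have /(pairs_impl _) := pairs_drop (size l - n) lR; apply.
move=> w a _ /dl al /conj2_trans; apply=> /=.
have sy' : size y' = size c by apply: sz; apply: lP'; rewrite mem_head.
have sa : size a = size c by apply: sz; apply: lP'; rewrite inE al orbT.
have [|||g [Gg _]] := colP (y' ++ a) (y ++ z).
- by rewrite size_cat sy' sa.
- by rewrite size_cat sy sz'.
- by rewrite lj' // lj // mem_head.
rewrite map_cat => /cat_inj[|? ?]; first by rewrite size_map sy' sy.
by exists g.
Qed.

Hypothesis binarity : forall Z : seq (M * M),
  (forall p q, p \in Z -> q \in Z -> conj2 [:: p.1] [:: q.1] [:: p.2] [:: q.2]) ->
  exists2 g, G g & forall p, p \in Z -> g p.1 = p.2.

Lemma morley_conj A c l l' r : size l = size l' ->
  (forall a, a \in l -> conj2 A c A a) -> (forall a, a \in l' -> conj2 A c A a) ->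
  pairs (fun w z => conj2 w z r.1 r.2) l ->
  pairs (fun w z => conj2 w z r.1 r.2) l' ->
  exists g, [/\ G g, map g A = A & map (map g) l = l'].
Proof.
move=> sl lP lP' lR lR'.
have LA p : p \in zip l l' -> conj2 A p.1 A p.2.
  by move=> /mem_zip[/lP/conj2_sym h /lP' h']; exact: conj2_trans h h'.
have LL p q : p \in zip l l' -> q \in zip l l' -> conj2 p.1 q.1 p.2 q.2.
  elim: l l' sl {lP lP'} lR lR' LA => [|a l IH] [|a' l'] //= [sl].
  move=> [aR lR] [aR' lR'] LA.
  have aq x : x \in zip l l' -> conj2 a x.1 a' x.2.
    move=> /mem_zip[/aR h1 /aR' /conj2_sym h2]; exact: conj2_trans h1 h2.
  rewrite !inE => /orP[/eqP->|pl] /orP[/eqP->|ql] /=.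
  - by have [g [Gg _ ga]] := LA _ (mem_head _ _); exists g.
  - exact: aq.
  - exact/conj2_swap/aq.
  - by apply: (IH l') => // x xl; apply: LA; rewrite inE xl orbT.
have cz a b a' b' p q : conj2 a b a' b' -> p \in zip a a' -> q \in zip b b' ->
    conj2 [:: p.1] [:: q.1] [:: p.2] [:: q.2].
  move=> [g [Gg <- <-]] /zip_map-> /zip_map->; by exists g.
have [p q|g Gg gZ] := binarity
    (Z := zip A A ++ flatten [seq zip p.1 p.2 | p <- zip l l']).
  have AA : conj2 A A A A by exact: conj2_refl.
  rewrite !mem_cat => /orP[pA|/flatten_mapP[p' pl pp]].
    move=> /orP[qA|/flatten_mapP[q' ql qq]]; first exact: cz AA pA qA.
    exact: (cz _ _ _ _ _ _ (LA _ ql)).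
  move=> /orP[qA|/flatten_mapP[q' ql qq]].
    exact: (cz _ _ _ _ _ _ (conj2_swap (LA _ pl))).
  exact: (cz _ _ _ _ _ _ (LL _ _ pl ql)).
exists g; split=> //.
  by apply: map_zip => // p pA; apply: gZ; rewrite mem_cat pA.
apply: map_zip => // p pl; have [h [_ _ hp]] := LA p pl.
apply: map_zip; first by rewrite -hp size_map.
move=> q qp; apply: gZ; rewrite mem_cat; apply/orP; right.
by apply/flatten_mapP; exists p.
Qed.

Theorem morley_distinct A A' c b r k : {subset A <= A'} -> {subset b <= A'} ->
  kdiv k A c b -> morley A c r -> ~ morley A' c r.
Proof.
move=> AA' bA' d mor mor'.
have {d} : div A c b.
  by exists k; apply: kdiv_mono d => // x; rewrite mem_cat orbC => ->.
(* Now it is the type of [b] that divides, at the parameter [c]. It does so at each member of [l']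
   too, as these have the type of [c] over A', which contains [b]. *)
apply: indep_sym; move=> [{}k d].
have [N NP] := kim A k (size b) (size c).
have [l [sl il lP lR]] := mor N.+1; have [l' [sl' il' lP' lR']] := mor' N.+1.
have lP'' a : a \in l' -> conj2 A' c A' a /\ conj2 A c A a.
  move=> /lP'[g [Gg gA' ga]]; split; exists g; split=> //.
  exact: map_id_sub gA'.
(* [l'] is given as independent over A' only; conjugacy with [l] over A makes it independent over A,
   as [kim] requires. *)
have [||g [Gg gA gl]] := @morley_conj A c l l' r _ lP _ lR lR'.
- by rewrite sl sl'.
- by move=> a /lP''[].
suff : size l' <= N by rewrite sl' ltnn.
apply: (NP b) => //; first by rewrite -gl; exact: indep_map.
move=> a /lP'[h [Gh hA' ha]]; split; first by rewrite -ha size_map.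
have := kdiv_map Gh d; rewrite map_cat ha.
by rewrite !(map_id_sub _ hA').
Qed.

End Orbits.

(** * Finite partial isomorphisms between models *)

HB.instance Definition _ (L : vocabulary) := gen_eqMixin (symb L).
HB.instance Definition _ (L : vocabulary) (N : structure L) :=
  gen_eqMixin (carrier N).

Section Formulas.

Variable L : vocabulary.

Lemma sat_rename (N : structure L) V (f : form L V) W (h : V -> W) (v : W -> N) :
  sat (rename f h) v <-> sat f (v \o h).
Proof.
elim: f W h v => //= {V} [V f IHf g IHg|V f IH] W h v.
  by split=> fg /IHf /fg /IHg.
have E a : oapp v a \o omap h = oapp (v \o h) a by apply/funext; case.
by split=> fP a; move: (fP a); rewrite IH E.
Qed.

Definition Fnot V (f : form L V) := Fimp f Fbot.
Definition Fand V (f g : form L V) := Fnot (Fimp f (Fnot g)).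

Lemma sat_and (N : structure L) V (f g : form L V) (v : V -> N) :
  sat (Fand f g) v <-> sat f v /\ sat g v.
Proof.
split=> /= [H|[fv gv] /(_ fv gv)//].
by apply: contrapT => nfg; apply: H => fv gv; apply: nfg.
Qed.

Definition Fbig V (T : Type) (s : seq T) (F : T -> form L V) : form L V :=
  foldr (fun x => Fand (F x)) (Fnot Fbot) s.

Lemma sat_big (N : structure L) V (T : eqType) (s : seq T) F (v : V -> N) :
  sat (Fbig s F) v <-> forall x, x \in s -> sat (F x) v.
Proof.
elim: s => [|x s IH]; first by split=> [_ x|_ []].
rewrite [Fbig _ _]/= sat_and IH; split=> [[Fx Fs] y|Fs].
  by rewrite inE => /orP[/eqP->|/Fs].
by split=> [|y ys]; apply: Fs; rewrite inE ?eqxx ?ys ?orbT.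
Qed.

Definition Flit V (P : Prop) (f : form L V) := if `[< P >] then f else Fnot f.

Lemma sat_lit (N : structure L) V P (f : form L V) (v : V -> N) :
  sat (Flit P f) v <-> (P <-> sat f v).
Proof. by rewrite /Flit; case: asboolP => HP /=; tauto. Qed.

(** Defined for every [n], so that arities known only through [binary] need no casts: it is x for n
    = 1 and (x, y) for n = 2. *)
Definition pair_env (n : nat) (T : Type) (x y : T) (k : 'I_n) : T :=
  if val k == 0 then x else y.

Lemma pair_env_comp n T T' (g : T -> T') x y :
  g \o @pair_env n T x y = pair_env (g x) (g y).
Proof. by apply/funext => k; rewrite /= /pair_env; case: ifP. Qed.

Definition at2 (N N' : structure L) (x y : N) (x' y' : N') : Prop :=
  (x = y <-> x' = y') /\ forall r : symb L,
    interp (@pair_env (arity r) _ x y) <-> interp (@pair_env (arity r) _ x' y').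

Definition same (N N' : structure L) I (u : I -> N) (u' : I -> N') : Prop :=
  forall i j, at2 (u i) (u j) (u' i) (u' j).

Lemma same_sym (N N' : structure L) I (u : I -> N) (u' : I -> N') :
  same u u' -> same u' u.
Proof.
move=> s i j; have [? sr] := s i j.
by split=> [|r]; [tauto|have := sr r; tauto].
Qed.

Lemma same_trans (N1 N2 N3 : structure L) I (u1 : I -> N1) (u2 : I -> N2)
    (u3 : I -> N3) : same u1 u2 -> same u2 u3 -> same u1 u3.
Proof.
move=> s t i j; have [? sr] := s i j; have [? tr] := t i j.
by split=> [|r]; [tauto|have := sr r; have := tr r; tauto].
Qed.

Lemma same_comp (N N' : structure L) I J (h : J -> I) (u : I -> N) (u' : I -> N') :
  same u u' -> same (u \o h) (u' \o h).
Proof. by move=> s i j; exact: s. Qed.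

Lemma same_atomic (N N' : structure L) I (u : I -> N) (u' : I -> N') :
  (forall i j, sat (Feq i j) u <-> sat (Feq i j) u') ->
  (forall (r : symb L) i j, sat (Frel r (pair_env i j)) u <->
     sat (Frel r (pair_env i j)) u') -> same u u'.
Proof.
move=> He Hr i j; split=> [|r]; first exact: He.
by have := Hr r i j; rewrite /= !pair_env_comp.
Qed.

Lemma elementary_same (N N' : structure L) (e : N -> N') : elementary e ->
  forall I (u : I -> N), same u (e \o u).
Proof.
move=> ee I u i j.
have s : same (@pair_env 2 _ (u i) (u j)) (e \o pair_env (u i) (u j)).
  by apply: same_atomic => *; exact: ee.
exact: (s ord0 ord_max).
Qed.

Lemma automorphism_same (M : structure L) (g : M -> M) : automorphism g ->
  forall I (u : I -> M), same u (g \o u).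
Proof.
move=> [[h gh hg] gr] I u i j; split=> [|r]; first by split=> /= [->|/(can_inj gh)].
by rewrite gr pair_env_comp.
Qed.

Hypothesis L_binary : binary L.

Lemma tuple_pair (r : symb L) : exists i j : 'I_(arity r),
  forall T (t : 'I_(arity r) -> T), t = pair_env (t i) (t j).
Proof.
rewrite /pair_env; case: (L_binary r) => ->.
  exists ord0, ord0 => T t; apply/funext => k; rewrite ord1 //.
exists ord0, ord_max => T t; apply/funext => k.
case: eqP => [k0|]; first by congr t; exact: val_inj.
by case: k => [[|[|]]] //= h _; congr t; exact: val_inj.
Qed.

Hypothesis L_finite : finite_set [set: symb L].

Lemma symbols : exists s : seq (symb L), forall r, r \in s.
Proof.
have /finite_seqP[s sE] := L_finite; exists s => r.
by have : [set: symb L] r by []; rewrite sE.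
Qed.

Lemma diagram (N : structure L) (V : finType) (v : V -> N) :
  exists f : form L V, forall (N' : structure L) (w : V -> N'),
    sat f w <-> same v w.
Proof.
have [s sP] := symbols.
exists (Fbig (enum {: V * V}) (fun p => Fand (Flit (v p.1 = v p.2) (Feq p.1 p.2))
  (Fbig s (fun r => Flit (@interp L N r (pair_env (v p.1) (v p.2)))
     (Frel r (pair_env p.1 p.2)))))) => N' w.
rewrite sat_big; split=> [H i j|H [i j] _].
  have /sat_and[/sat_lit e] := H (i, j) (mem_enum _ _).
  move=> /sat_big sr; split=> // r.
  by have /sat_lit /= := sr r (sP r); rewrite pair_env_comp.
have [e sr] := H i j; rewrite sat_and sat_lit sat_big; split=> // r _.
by rewrite sat_lit /= pair_env_comp.
Qed.

Fixpoint closure n : form L 'I_n -> form L void :=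
  match n with
  | 0 => fun f => rename f (fun i : 'I_0 => False_rect void (notF (valP i)))
  | n'.+1 => fun f => closure (Fall (rename f (unlift ord0)))
  end.

Lemma sat_closure (N : structure L) n (f : form L 'I_n) (e : void -> N) :
  sat (closure f) e <-> forall v : 'I_n -> N, sat f v.
Proof.
elim: n f => [|n IH] f /=.
  rewrite sat_rename; split=> [H v|]; last exact.
  have E (w : 'I_0 -> N) : w = v by apply/funext => -[].
  by move: H; rewrite (E (e \o _)).
rewrite IH; split=> H v => [|a].
  have /sat_rename := H (v \o lift ord0) (v ord0).
  rewrite (_ : _ \o unlift ord0 = v) //; apply: funext => i.
  by case: (unliftP ord0 i) => [j|] -> /=; rewrite ?liftK ?unlift_none.
by apply/sat_rename; exact: H.
Qed.

End Formulas.

(** * Back-and-forth and quantifier elimination *)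

Section Models.

Variables (L : vocabulary) (M : structure L).
Hypothesis L_binary : binary L.
Hypothesis M_homogeneous : homogeneous M.

Let L_finite : finite_set [set: symb L].
Proof. by case: M_homogeneous. Qed.

Lemma models_realize (N : structure L) n (f : form L 'I_n) (v : 'I_n -> N) :
  models (Th M) N -> sat f v -> exists w : 'I_n -> M, sat f w.
Proof.
move=> MN fv; apply: contrapT => nw.
have /MN/sat_closure/(_ v) : Th M (closure (Fnot f)).
  by rewrite /Th /= sat_closure => w fw; apply: nw; exists w.
exact.
Qed.

Lemma same_conj (I : finType) (u u' : I -> M) :
  same u u' -> exists2 g, automorphism g & forall i, g (u i) = u' i.
Proof.
move=> s; case: M_homogeneous => _ _ H.
have /choice[f fP] x : exists y, forall i, u i = x -> y = u' i.
  have [[i <-]|nx] := pselect (exists i, u i = x).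
    by exists (u' i) => j /esym uij; have [[+ _] _] := s i j; apply.
  by exists x => i ui; case: nx; exists i.
have fu i : f (u i) = u' i by exact: fP.
have fin (w : I -> M) : finite_set (range w).
  exact: finite_image.
have [|g ga gf] := H (range u) (range u') f (fin u) (fin u').
  split.
    split.
    - by move=> _ [i _ <-]; exists i.
    - move=> x y; rewrite !inE => -[i _ <-] [j _ <-]; rewrite !fu => uij.
      by have [[_ ->]] := s i j.
    - by move=> _ [i _ <-]; exists (u i); [exists i|exact: fu].
  move=> r t tA; have [i [j tP]] := tuple_pair L_binary r.
  have [i' _ ui] := tA i; have [j' _ uj] := tA j.
  rewrite (tP _ t) -ui -uj pair_env_comp !fu.
  by have [_ ->] := s i' j'.
by exists g => // i; rewrite gf //; exists i.
Qed.

Definition cons_env n (T : Type) (v : 'I_n -> T) (a : T) (i : 'I_n.+1) : T :=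
  oapp v a (unlift ord0 i).

Lemma cons_env_lift n T (v : 'I_n -> T) a : cons_env v a \o lift ord0 = v.
Proof. by apply/funext => i; rewrite /cons_env /= liftK. Qed.

(** Diagrams are single formulas, so a failure of one-point extension between two models can be
    expressed by a formula and realised in M, where homogeneity refutes it. *)
Lemma extend_one (N N' : structure L) n (u : 'I_n -> N) (u' : 'I_n -> N') a :
  models (Th M) N -> models (Th M) N' -> same u u' ->
  exists a', same (cons_env u a) (cons_env u' a').
Proof.
move=> MN MN' s; apply: contrapT => na.
have [D DP] := diagram L_finite u.
have [E EP] := diagram L_finite (cons_env u a).
pose F := Fand D (Fall (Fnot (rename E (unlift ord0)))).
have satF (N1 : structure L) (v : 'I_n -> N1) :
    sat F v <-> same u v /\ forall b, ~ same (cons_env u a) (cons_env v b).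
  rewrite sat_and DP /=; split=> -[uv H]; split=> // b; move: (H b).
    by rewrite sat_rename EP.
  by rewrite sat_rename EP.
have : sat F u' by apply/satF; split=> // b sb; apply: na; exists b.
move=> /(models_realize MN')[w /satF[sw nw]].
have /(models_realize MN)[w1 /EP sw1] : sat E (cons_env u a) by apply/EP.
have : same (w1 \o lift ord0) w.
  apply: same_trans sw; apply: same_sym.
  by have := same_comp (lift ord0) sw1; rewrite cons_env_lift.
move=> /same_conj[g ga gw]; apply: (nw (g (w1 ord0))).
have -> : cons_env w (g (w1 ord0)) = g \o w1.
  apply/funext => i; rewrite /cons_env.
  by case: (unliftP ord0 i) => [j|] ->; rewrite ?liftK ?unlift_none //= -gw.
by apply: same_trans sw1 _; apply: automorphism_same.
Qed.

(* [PI Z] says that the finite relation [Z] is a partial isomorphism. *)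
Definition PI (N N' : structure L) (Z : seq (N * N')) : Prop :=
  forall p q, p \in Z -> q \in Z -> at2 p.1 q.1 p.2 q.2.

Lemma PI_extend (N N' : structure L) (Z : seq (N * N')) a :
  models (Th M) N -> models (Th M) N' -> PI Z -> exists a', PI ((a, a') :: Z).
Proof.
move=> MN MN' PZ; pose t i := tnth (in_tuple Z) i.
have [i j|a' s] :=
    @extend_one N N' _ (fun i => (t i).1) (fun i => (t i).2) a MN MN'.
  by apply: PZ; exact: mem_tnth.
exists a'; suff ZP p : p \in (a, a') :: Z -> exists i,
    p = (cons_env (fun i => (t i).1) a i, cons_env (fun i => (t i).2) a' i).
  by move=> p q /ZP[i ->] /ZP[j ->]; exact: s.
rewrite inE => /orP[/eqP->|pZ].
  by exists ord0; rewrite /cons_env unlift_none.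
have /tnthP[i ip] : p \in in_tuple Z by [].
by exists (lift ord0 i); rewrite /cons_env liftK /= /t -ip; case: (p).
Qed.

Lemma PI_sym (N N' : structure L) (Z : seq (N * N')) :
  PI Z -> PI [seq (p.2, p.1) | p <- Z].
Proof.
move=> PZ _ _ /mapP[p pZ ->] /mapP[q qZ ->] /=.
have [? r] := PZ p q pZ qZ.
by split=> [|s]; [tauto|have := r s; tauto].
Qed.

(** One-point extension does the work of saturation of [N']: each new element is placed over
    finitely many earlier ones. This lets infinite dividing witnesses be copied into M. *)
Lemma same_extend (N N' : structure L) (I : finType) (C : countType)
    (u : I -> N) (u' : I -> N') (w : C -> N) :
  models (Th M) N -> models (Th M) N' -> same u u' ->
  exists w', same (join_env u w) (join_env u' w').
Proof.
move=> MN MN' s.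
have /choice[nxt nxtP] (q : seq (N * N') * N) :
    exists a', PI q.1 -> PI ((q.2, a') :: q.1).
  have [/(PI_extend q.2 MN MN')[a' ?]|nP] := pselect (PI q.1); first by exists a'.
  (* Only makes [nxt] total: the empty relation is a partial isomorphism, which provides some
     element of [N']. *)
  by have [|a' _] := @PI_extend N N' [::] q.2 MN MN'; last exists a'.
pose fix st n := if n is n'.+1 then
    if unpickle n' is Some c then (w c, nxt (st n', w c)) :: st n' else st n'
  else [seq (u i, u' i) | i <- enum I].
have stP n : PI (st n).
  elim: n => [|n IH] /=; last by case: unpickle => // c; exact: (nxtP (st n, w c)).
  by move=> _ _ /mapP[i _ ->] /mapP[j _ ->]; exact: s.
have st_le m n : m <= n -> {subset st m <= st n}.
  move=> /subnKC <-; elim: (n - m) => [|k IH] x; first by rewrite addn0.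
  by move=> /IH xk; rewrite addnS /=; case: unpickle => // c; rewrite inE xk orbT.
exists (fun c => nxt (st (pickle c), w c)).
have join_st x : exists n, (join_env u w x,
    join_env u' (fun c => nxt (st (pickle c), w c)) x) \in st n.
  case: x => [i|c]; first by exists 0; apply/mapP; exists i; rewrite ?mem_enum.
  by exists (pickle c).+1; rewrite /= pickleK mem_head.
move=> x y; have [m xm] := join_st x; have [n yn] := join_st y.
exact: (stP (maxn m n) _ _ (st_le _ _ (leq_maxl _ _) _ xm)
          (st_le _ _ (leq_maxr _ _) _ yn)).
Qed.

(** Quantifier elimination by back-and-forth. The finite relation [Z] only has to contain the values
    of both environments, so the induction is free of the type of variables, which changes under
    [Fall]. *)
Lemma sat_PI V (f : form L V) (N N' : structure L) (v : V -> N) (v' : V -> N') Z :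
  models (Th M) N -> models (Th M) N' -> PI Z ->
  (forall x, (v x, v' x) \in Z) -> sat f v <-> sat f v'.
Proof.
move=> MN MN'; elim: f v v' Z => {V} //=.
- by move=> V x y v v' Z PZ vZ; have [] := PZ _ _ (vZ x) (vZ y).
- move=> V r t v v' Z PZ vZ; have [i [j tP]] := tuple_pair L_binary r.
  rewrite (tP _ t) !pair_env_comp.
  by have [_ /(_ r)] := PZ _ _ (vZ (t i)) (vZ (t j)).
- move=> V f IHf g IHg v v' Z PZ vZ.
  by rewrite (IHf _ _ _ PZ vZ) (IHg _ _ _ PZ vZ).
move=> V f IH v v' Z PZ vZ; split=> H a.
  have [a' /PI_sym PZ'] := PI_extend a MN' MN (PI_sym PZ).
  rewrite -(IH (oapp v a') _ _ PZ') // => -[x|]; last by rewrite /= mem_head.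
  rewrite /= inE; apply/orP; right; rewrite -map_comp.
  by apply/mapP; exists (v x, v' x).
have [a' PZ'] := PI_extend a MN MN' PZ.
rewrite (IH _ (oapp v' a') _ PZ') //.
by move=> [x|]; rewrite inE /= ?vZ ?orbT ?eqxx.
Qed.

Lemma sat_same (V : finType) (f : form L V) (N N' : structure L)
    (v : V -> N) (v' : V -> N') :
  models (Th M) N -> models (Th M) N' -> same v v' -> sat f v <-> sat f v'.
Proof.
move=> MN MN' s.
apply: (@sat_PI _ _ _ _ _ _ [seq (v i, v' i) | i <- enum V]) => //.
  by move=> _ _ /mapP[i _ ->] /mapP[j _ ->]; exact: s.
by move=> x; apply/mapP; exists x; rewrite ?mem_enum.
Qed.

End Models.

Lemma nth_codom_ord n (T : Type) x0 (d : 'I_n -> T) (i : 'I_n) :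
  nth x0 (codom d) i = d i.
Proof. by rewrite (nth_map i) ?nth_ord_enum ?size_enum_ord. Qed.

Lemma simple_structure_inhabited (L : vocabulary) (M : structure L) :
  simple_structure M -> exists x : M, True.
Proof.
move=> [Minf _]; apply: contrapT => nM; apply: Minf.
rewrite (_ : [set: M] = set0); first exact: finite_set0.
by rewrite predeqE => x; split=> // _; apply: nM; exists x.
Qed.

(** * Chains of dividing types *)

Section Rank.

Variables (L : vocabulary) (M : structure L).
Hypothesis L_binary : binary L.
Hypothesis M_homogeneous : homogeneous M.
Hypothesis M_simple : simple_structure M.

Local Notation aut := (@automorphism L M).
Local Notation T := (Th M).

Let M_models : models T M.
Proof. by []. Qed.

Let M_inhabited : exists x : M, True := simple_structure_inhabited M_simple.

Let L_finite : finite_set [set: symb L].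
Proof. by case: M_homogeneous. Qed.

(** * The automorphism group of M *)

Lemma aut_id : aut id.
Proof. by split=> //; exists id. Qed.

Lemma aut_comp f g : aut f -> aut g -> aut (f \o g).
Proof.
move=> [bf fr] [bg gr]; split; first exact: bij_comp.
by move=> r t; rewrite gr fr.
Qed.

Lemma aut_inv f : aut f -> exists2 g, aut g & cancel f g /\ cancel g f.
Proof.
move=> [[g fg gf] fr]; exists g => //; split; first by exists f.
move=> r t; rewrite [X in _ <-> X]fr.
by rewrite (_ : f \o (g \o t) = t) //; apply/funext => i /=; rewrite gf.
Qed.

Lemma seq_conj (x0 : M) (n : nat) (s t : seq M) : size s = n -> size t = n ->
  same (fun i : 'I_n => nth x0 s i) (fun i : 'I_n => nth x0 t i) ->
  exists2 g, aut g & map g s = t.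
Proof.
move=> ss st /(same_conj L_binary M_homogeneous)[g ga gs]; exists g => //.
apply: (@eq_from_nth _ x0); rewrite size_map ss ?st // => i ik.
by rewrite (nth_map x0) ?ss // (gs (Ordinal ik)).
Qed.

Lemma aut_finite_orbits n : exists P (col : seq M -> 'I_P),
  forall s t, size s = n -> size t = n -> col s = col t ->
    conj2 aut [::] s [::] t.
Proof.
have [x0 _] := M_inhabited; have [sy syP] := symbols L_finite.
pose F := {ffun 'I_n * 'I_n -> bool * {ffun 'I_(size sy) -> bool}}.
pose col (s : seq M) : F := [ffun p : 'I_n * 'I_n =>
  (`[< nth x0 s p.1 = nth x0 s p.2 >],
  [ffun k => `[< @interp L M (tnth (in_tuple sy) k)
     (pair_env (nth x0 s p.1) (nth x0 s p.2)) >]])].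
exists #|F|, (fun s => enum_rank (col s)) => s t ss st /enum_rank_inj/ffunP st'.
have [|g ga gs] := @seq_conj x0 n s t ss st; last by exists g.
move=> i j; have := st' (i, j); rewrite !ffunE => -[e /ffunP r].
split=> [|r']; first exact: asbool_eq_equiv e.
have /tnthP[k ->] : r' \in in_tuple sy by exact: syP.
by have := r k; rewrite !ffunE; exact: asbool_eq_equiv.
Qed.

Lemma aut_binarity (Z : seq (M * M)) :
  (forall p q, p \in Z -> q \in Z ->
    conj2 aut [:: p.1] [:: q.1] [:: p.2] [:: q.2]) ->
  exists2 g, aut g & forall p, p \in Z -> g p.1 = p.2.
Proof.
move=> ZP; have [|g ga gZ] := @same_conj _ _ L_binary M_homogeneous _
    (fun i => (tnth (in_tuple Z) i).1) (fun i => (tnth (in_tuple Z) i).2).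
  move=> i j; have [g [ga [<-] [<-]]] :=
    ZP _ _ (mem_tnth i (in_tuple Z)) (mem_tnth j (in_tuple Z)).
  exact: (automorphism_same ga (fun b : bool =>
    if b then (tnth (in_tuple Z) i).1 else (tnth (in_tuple Z) j).1) true false).
exists g => // p pZ; have /tnthP[i ->] : p \in in_tuple Z by [].
exact: gZ.
Qed.

(** By homogeneity the diagram of (c, b) defines its orbit, so the tree from [dividing_tree] is the
    tree property for that formula. *)
Lemma aut_chain_bounded k c b : exists N, forall c' bs,
  chain aut k [::] c' bs -> (forall b', b' \in bs -> conj2 aut c b c' b') ->
  size bs <= N.
Proof.
apply: contrapT => nN; have [x0 _] := M_inhabited.
have [|a [aI aP]] := dividing_tree aut_id aut_comp aut_inv aut_finite_orbits
    (k := k) (c := c) (b := b).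
  move=> n; apply: contrapT => nn; apply: nN; exists n => c' bs ch bsP.
  rewrite leqNgt; apply/negP => nbs; apply: nn; exists c', (take n bs); split.
  - by rewrite size_takel // ltnW.
  - by move: ch; rewrite -{1}(cat_take_drop n bs) => /chain_catl.
  - by move=> b' /mem_take /bsP.
(* The tree is not given with sizes; they are read off the branch [nth 0 t], which passes through
   [t]. *)
have sa t : size (a t) = size b.
  have [c'] := aP (nth 0 t) (size t).+1; move=> /(_ (size t) (ltnSn _)).
  by rewrite mkseq_nth => -[g [_ _ <-]]; rewrite size_map.
case: M_simple => _ simple.
have [f fP] := diagram L_finite (join_env (fun i : 'I_(size c) => nth x0 c i)
  (fun j : 'I_(size b) => nth x0 b j)).
apply: (simple _ _ f); exists k, M, (fun t j => nth x0 (a t) j).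
split=> // [t I uI sI [d dP]|sigma l].
  apply: (aI t I uI sI); exists (codom d) => i /dP /fP.
  move=> /(same_conj L_binary M_homogeneous)[g ga gd]; exists g; split=> //.
    apply: (@eq_from_nth _ x0) => [|j];
      rewrite size_map ?size_codom ?card_ord // => jc.
    rewrite (nth_map x0) // (gd (inl (Ordinal jc))) /=.
    by rewrite -[j in RHS]/(val (Ordinal jc)) nth_codom_ord.
  apply: (@eq_from_nth _ x0) => [|j]; rewrite size_map ?sa // => jb.
  by rewrite (nth_map x0) // (gd (inr (Ordinal jb))).
have [c' c'P] := aP sigma l; exists (nth x0 c') => j /c'P[g [ga gc gb]].
apply/fP; have /(_ _ (join_env (fun i : 'I_(size c) => nth x0 c i)
  (fun i : 'I_(size b) => nth x0 b i))) := automorphism_same ga.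
congr (same _ _); apply/funext => -[i|i] /=; rewrite -?gc -?gb (nth_map x0) //.
Qed.

(** Unlike in [chain], every step has its own k. *)
Fixpoint dchain (A c : seq M) (bs : seq (seq M)) : Prop :=
  if bs is b :: bs' then (exists k, kdiv aut k A c b) /\ dchain (A ++ b) c bs'
  else True.

Lemma dchain_mid A c bs b cs :
  dchain A c (bs ++ b :: cs) -> exists k, kdiv aut k (A ++ flatten bs) c b.
Proof.
elim: bs A => /= [A [d _]|b' bs IH A [_ /IH]]; first by rewrite cats0.
by rewrite catA.
Qed.

(** A chain of n steps has n + 1 bases, and [r i] comes from the base formed by the first i tuples.
    For i < j the tuple of step i lies in base j, so [morley_distinct] applies. *)
Lemma dchain_types c bs : dchain [::] c bs ->
  exists r : nat -> seq M * seq M,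
    (forall i, size (r i).1 = size c /\ size (r i).2 = size c) /\
    forall i j, i < j -> j <= size bs ->
      ~ conj2 aut (r i).1 (r i).2 (r j).1 (r j).2.
Proof.
move=> ch.
have /choice[r rP] i := morley_exists aut_id aut_comp aut_inv aut_finite_orbits
  aut_chain_bounded (flatten (take i bs)) c.
exists r; split=> [i|i j ij jbs cij]; first by have [] := rP i.
have ibs : i < size bs by apply: leq_trans jbs.
have [k d] : exists k, kdiv aut k (flatten (take i bs)) c (nth [::] bs i).
  apply: (@dchain_mid [::] _ _ _ (drop i.+1 bs)).
  by rewrite -drop_nth // cat_take_drop.
have sub l : l <= j -> {subset flatten (take l bs) <= flatten (take j bs)}.
  move=> lj x; rewrite -(subnKC lj) takeD flatten_cat mem_cat => ->.
  by [].
have [_ _ mi] := rP i; have [_ _ mj] := rP j.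
apply: (morley_distinct aut_id aut_comp aut_inv aut_finite_orbits
  aut_chain_bounded aut_binarity (sub i (ltnW ij)) _ d _ mj).
  move=> x xb; apply: (sub i.+1 ij); rewrite (take_nth [::]) // -cats1.
  by rewrite flatten_cat /= cats0 mem_cat xb orbT.
move=> n; have [l [sl il lP lR]] := mi n; exists l; split=> //.
apply: pairs_impl lR => w z _ _ wz.
exact: (conj2_trans aut_comp wz cij).
Qed.

(** * Copying finite configurations into M *)

Definition respects (N N' : structure L) (phi : N -> N') (s : seq N) : Prop :=
  forall x y, x \in s -> y \in s -> at2 x y (phi x) (phi y).

Lemma respects_sub (N N' : structure L) (phi : N -> N') s s' :
  {subset s <= s'} -> respects phi s' -> respects phi s.
Proof. by move=> ss' phiP x y /ss' xs /ss' ys; exact: phiP. Qed.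

Lemma respects_same (N N' : structure L) (phi : N -> N') s I (u : I -> N) :
  respects phi s -> (forall i, u i \in s) -> same u (phi \o u).
Proof. by move=> phiP us i j; exact: phiP. Qed.

Lemma embed (N : structure L) (s : seq N) : models T N ->
  exists phi : N -> M, respects phi s.
Proof.
move=> MN; have [x0 _] := M_inhabited.
have nil (X : Type) : 'I_0 -> X by case.
have [[]//|w' s'] :=
  @same_extend _ _ L_binary M_homogeneous N M _ _ (@nil _) (@nil _)
    (tnth (in_tuple s)) MN M_models.
have /choice[phi phiP] x : exists y, x \in s ->
    exists2 i, x = tnth (in_tuple s) i & y = w' i.
  case: (boolP (x \in s)) => [xs|_]; last by exists x0.
  have /tnthP[i ->] : x \in in_tuple s by [].
  by exists (w' i) => _; exists i.
exists phi => x y /phiP[i -> ->] /phiP[j -> ->]; exact: (s' (inr i) (inr j)).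
Qed.

Lemma elementary_models (N N' : structure L) (e : N -> N') :
  elementary e -> models T N -> models T N'.
Proof.
move=> ee MN f /MN; rewrite /Th /=.
have E (N1 : structure L) (v : 'I_0 -> N1) :
    sat f (of_void N1) <-> sat (rename f (of_void 'I_0)) v.
  by rewrite sat_rename (_ : v \o _ = of_void N1) //; apply/funext => -[].
have v : 'I_0 -> N by case.
by rewrite (E N v) (E N' (e \o v)) => /ee.
Qed.

(* Dividing of [tp(c/b)] over [A] in an arbitrary model, read off from the
   copies of [A c b] in [M]. *)
Definition tdiv (N : structure L) (A c b : seq N) : Prop :=
  forall phi : N -> M, respects phi (A ++ c ++ b) ->
    exists k, kdiv aut k (map phi A) (map phi c) (map phi b).

Lemma codom_comp (I : finType) (X Y : Type) (g : X -> Y) (u : I -> X) :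
  codom (g \o u) = map g (codom u).
Proof. exact: map_comp. Qed.

Lemma map_codom_eq (n : nat) (u : 'I_n -> M) (h : M -> M) l x0 :
  map h (codom u) = l -> forall j : 'I_n, h (u j) = nth x0 l j.
Proof.
move=> <- j; rewrite (nth_map x0) ?nth_codom_ord //.
by rewrite size_codom card_ord.
Qed.

(** The model [N'] of the dividing sequence and the model [N] of [c] extend [N1] separately; they
    meet in M. The sequence is copied there over the given copy of A and b, and homogeneity provides
    automorphisms along it. *)
Lemma divides_tdiv (N1 N : structure L) (E : N1 -> N) (B : set N1) n m
    (f : form L ('I_n + 'I_m)) (b : 'I_m -> N1) (c : 'I_n -> N) (A : seq N1) :
  models T N1 -> elementary E -> divides B f b -> sat f (join_env c (E \o b)) ->
  (forall x, x \in A -> B x) -> tdiv (map E A) (codom c) (codom (E \o b)).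
Proof.
move=> MN1 eE [k [N' [e [s [ee stp sk]]]]] fcb AB phi phiP.
have [x0 _] := M_inhabited.
have MN := elementary_models eE MN1; have MN' := elementary_models ee MN1.
pose al := tnth (in_tuple A); pose u := join_env al b.
have alA i : al i \in A by exact: mem_tnth.
have phiE : same (E \o u) (phi \o E \o u).
  apply: (respects_same phiP) => -[i|i]; rewrite !mem_cat.
    by rewrite /= map_f.
  by have /= -> := codom_f (E \o b) i; rewrite !orbT.
have eu := elementary_same ee u; have Eu := elementary_same eE u.
have [w' w'P] := same_extend L_binary M_homogeneous
  (fun p : nat * 'I_m => s p.1 p.2) MN' M_models
  (same_trans (same_sym eu) (same_trans Eu phiE)).
have us i : same u (join_env (e \o al) (s i)).
  pose h (x : 'I_(size A) + 'I_m) : 'I_m + {a | B a} :=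
    match x with inl j => inr (exist _ (al j) (AB _ (alA j))) | inr j => inl j end.
  have H : same (join_env b (fun a : {a | B a} => sval a))
                (join_env (s i) (fun a : {a | B a} => e (sval a))).
    have tpE g : sat g (join_env b (fun a : {a | B a} => sval a)) <->
        sat g (join_env (s i) (fun a : {a | B a} => e (sval a))).
      have := stp i; rewrite predeqE => /(_ g); rewrite /tp /=; tauto.
    by apply: same_atomic => *; exact: tpE.
  by move=> x y; move: (H (h x) (h y)); case: x; case: y.
have /choice[g gP] i : exists g, [/\ aut g,
    forall j, g (phi (E (al j))) = phi (E (al j)) &
    forall j, g (phi (E (b j))) = w' (i, j)].
  have [|g ga gP] := @same_conj _ _ L_binary M_homogeneous _ (phi \o E \o u)
      (join_env (phi \o E \o al) (fun j => w' (i, j))).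
    apply: same_trans (same_sym phiE) _; apply: same_trans (same_sym Eu) _.
    apply: same_trans (us i) _ => x y.
    pose h (x : 'I_(size A) + 'I_m) : ('I_(size A) + 'I_m) + nat * 'I_m :=
      match x with inl j => inl (inl j) | inr j => inr (i, j) end.
    by move: (w'P (h x) (h y)); case: x; case: y.
  exists g; split=> // j; [exact: (gP (inl j))|exact: (gP (inr j))].
exists k, g; split=> [i|I uI sI _ [c' c'P]].
  have [ga gA _] := gP i; split=> //.
  rewrite -map_comp -map_comp; apply/eq_in_map => x xA.
  have /tnthP[j ->] : x \in in_tuple A by [].
  exact: gA.
apply: (sk I uI sI); pose ga (j : 'I_n) := nth x0 c' j.
(* A common solution in M is carried back to [N'] by [same_extend], which starts from a finite
   family, so the sequence is cut after the largest index in [I]. *)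
pose K := (\max_(i <- I) i).+1.
have IK i : i \in I -> i < K.
  by move=> iI; rewrite ltnS; apply: (@leq_bigmax_seq _ I xpredT (fun i => i)).
have [|x xP] := @same_extend _ _ L_binary M_homogeneous M N' _ _
  (fun p : 'I_K * 'I_m => w' (val p.1, p.2)) (fun p => s (val p.1) p.2)
  ga M_models MN'.
  apply: same_sym => p q.
  exact: (w'P (inr (val p.1, p.2)) (inr (val q.1, q.2))).
exists x => i iI; have [h [ha hc hb]] := c'P _ iI.
rewrite -(sat_same L_binary M_homogeneous f MN MN' (v := join_env c (E \o b))) //.
apply: same_trans (respects_same phiP _) _ => [[j|j]|].
- by rewrite !mem_cat /= codom_f orbT.
- by rewrite !mem_cat; have /= -> := codom_f (E \o b) j; rewrite !orbT.
apply: same_trans (automorphism_same ha _) _ => y z.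
pose q (y : 'I_n + 'I_m) : 'I_K * 'I_m + 'I_n :=
  match y with inl j => inr j | inr j => inl (Ordinal (IK i iI), j) end.
have hcj j : h (phi (c j)) = ga j.
  by apply: (@map_codom_eq n (phi \o c)); rewrite codom_comp.
have hbj j : h (phi (E (b j))) = w' (i, j).
  have [_ _ <-] := gP i; move: hb; rewrite -codom_comp => hb.
  by rewrite (map_codom_eq x0 hb) -(map_codom_eq x0 erefl).
have := xP (q y) (q z).
by case: y => j; case: z => l /=; rewrite ?hcj ?hbj.
Qed.

(** * From SU-rank to chains *)

Fixpoint tchain (N : structure L) (A c : seq N) (bs : seq (seq N)) : Prop :=
  if bs is b :: bs' then tdiv A c b /\ tchain (A ++ b) c bs' else True.

Lemma tchain_dchain (N : structure L) (A c : seq N) bs (phi : N -> M) :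
  respects phi (A ++ c ++ flatten bs) -> tchain A c bs ->
  dchain (map phi A) (map phi c) (map (map phi) bs).
Proof.
elim: bs A => //= b bs IH A phiP [d ch]; split.
  apply: d; apply: respects_sub phiP => x.
  by rewrite !mem_cat => /or3P[] ->; rewrite ?orbT.
rewrite -map_cat; apply: IH => //; apply: respects_sub phiP => x.
by rewrite !mem_cat => /orP[/orP[]|/orP[]] ->; rewrite ?orbT.
Qed.

(** A realisation of the last type, in the last model, realises all the earlier ones. The induction
    needs an arbitrary finite part A of the parameters, because each step adds to the base the [b]
    of its dividing formula. *)
Lemma SU_tchain d n (p : ctype L d) : models T (base p) -> SU_ge (onat n) p ->
  exists (N : structure L) (E : base p -> N) (c : 'I_d -> N) bs,
    [/\ elementary E,
        forall f, formulas p f -> sat f (join_env c (fun a => E (sval a))),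
        size bs = n &
        forall A, (forall x, x \in A -> params p x) ->
          tchain (map E A) (codom c) bs].
Proof.
elim: n p => [|n IH] p Mp.
  by have [N [e [c [ee ->]]]] := ctypeP p; exists N, e, c, [::].
move=> /(_ tt)[q [[e [sub [ee pq [m [f [b [fb fdiv]]]]]]] qn]].
have Mq := elementary_models ee Mp.
have [N [E [c [bs [eE qc sbs ch]]]]] := IH q Mq qn.
exists N, (E \o e), c, (codom (fun i => E (sval (b i))) :: bs); split.
- by move=> l g v; rewrite (ee l g v) (eE l g (e \o v)).
- move=> g /pq/qc; rewrite sat_rename.
  by congr (sat g _); apply/funext => -[].
- by rewrite /= sbs.
move=> A AP; rewrite map_comp; split.
  apply: (divides_tdiv Mq eE fdiv) => [|_ /mapP[x /AP px ->]]; last by exists x.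
  have := qc _ fb; rewrite sat_rename.
  by congr (sat f _); apply/funext => -[].
have -> : codom (fun i => E (sval (b i))) = map E (codom (fun i => sval (b i))).
  by rewrite -codom_comp.
rewrite -map_cat; apply: ch => x; rewrite mem_cat.
move=> /orP[/mapP[y /AP py ->]|/codomP[i ->]].
  exact: (sub y py).
exact: svalP.
Qed.

Lemma SU_types d n (p : ctype L d) : models T (base p) -> SU_ge (onat n) p ->
  exists r : nat -> seq M * seq M,
    (forall i, size (r i).1 = d /\ size (r i).2 = d) /\
    forall i j, i < j -> j <= n -> ~ conj2 aut (r i).1 (r i).2 (r j).1 (r j).2.
Proof.
move=> Mp /(SU_tchain Mp)[N [E [c [bs [eE _ sbs /(_ [::]) ch]]]]].
have [phi phiP] := embed ([::] ++ codom c ++ flatten bs) (elementary_models eE Mp).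
have /(tchain_dchain phiP)/dchain_types[r [rs rP]] : tchain [::] (codom c) bs.
  exact: ch.
exists r; split=> [i|i j ij jn]; last by apply: rP; rewrite // size_map sbs.
by have := rs i; rewrite size_map size_codom card_ord.
Qed.

Lemma SU_bounded d : exists B, forall n (p : ctype L d),
  models T (base p) -> SU_ge (onat n) p -> n <= B.
Proof.
have [P [col colP]] := aut_finite_orbits (d + d); exists P => n p Mp.
move=> /(SU_types Mp)[r [rs rP]].
have inj : injective (fun i : 'I_n => col ((r i).1 ++ (r i).2)).
  move=> i j cij; apply/eqP; rewrite eqE /=; apply/negP => /negP nij.
  wlog ij : i j cij nij / i < j.
    move=> W; have [ij|ji|ij] := ltngtP i j; first exact: W ij.
      by apply: W ji => //; rewrite eq_sym.
    by rewrite ij eqxx in nij.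
  apply: (rP i j ij (ltnW (ltn_ord j))).
  have [[s1 s2] [t1 t2]] := (rs i, rs j).
  have [||g [ga _]] := colP _ _ _ _ cij; rewrite ?size_cat ?s1 ?s2 ?t1 ?t2 //.
  rewrite map_cat => /cat_inj[|? ?]; first by rewrite size_map s1 t1.
  by exists g.
by rewrite -[n]card_ord -[P]card_ord; exact: leq_card inj.
Qed.

Lemma SU_eq_nat d (p : ctype L d) : models T (base p) ->
  exists n, SU_eq p (onat n).
Proof.
move=> Mp; have [B BP] := SU_bounded d.
have ex : exists n, `[< SU_ge (onat n) p >] by exists 0; apply/asboolP => -[].
have le n : `[< SU_ge (onat n) p >] -> n <= B by move=> /asboolP; exact: BP.
case: (ex_maxnP ex le) => n /asboolP pn nmax; exists n; split=> // pn1.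
have /nmax : `[< SU_ge (onat n.+1) p >] by exact/asboolP.
by rewrite ltnn.
Qed.

Lemma types_card n (p : ctype L 1) : models T (base p) -> SU_ge (onat n) p ->
  `I_n #<= stone 2 T.
Proof.
move=> Mp /(SU_types Mp)[r [rs rP]]; have [x0 _] := M_inhabited.
pose v i : 'I_2 -> M := pair_env (head x0 (r i).1) (head x0 (r i).2).
pose t i : set (form L 'I_2) := [set f | sat f (v i)].
have tS i : stone 2 T (t i) by exists M; split=> //; exists (v i).
have tinj : {in `I_n &, injective t}.
  move=> i j; rewrite !inE /= => il jl tij; apply/eqP; apply/negP => /negP nij.
  wlog ij : i j il jl tij nij / i < j.
    move=> W; have [ij|ji|ij] := ltngtP i j; first exact: W ij.
      by apply: W ji => //; rewrite eq_sym.
    by rewrite ij eqxx in nij.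
  apply: (rP i j ij (ltnW jl)).
  have /(same_conj L_binary M_homogeneous)[g ga gv] : same (v i) (v j).
    have tE f : sat f (v i) <-> sat f (v j).
      by move: tij; rewrite predeqE => /(_ f).
    by apply: same_atomic => *; exact: tE.
  have [[s1 s2] [t1 t2]] := (rs i, rs j).
  have hd s : size s = 1 -> s = [:: head x0 s] by case: s => [|? []].
  rewrite (hd _ s1) (hd _ s2) (hd _ t1) (hd _ t2); exists g; split=> //.
    by have := gv ord0; rewrite /v /pair_env /= => ->.
  by have := gv ord_max; rewrite /v /pair_env /= => ->.
have := inj_card_eq tinj; move/card_eqPle => [_ h]; apply: card_le_trans h _.
by apply: subset_card_le => _ [i _ <-].
Qed.

(** * Comparison of ordinals *)

Lemma ole_trans a b c : ole a b -> ole b c -> ole a c.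
Proof.
elim: a b c => X f IH [Y g] [Z h] /= ab bc i.
have [j fg] := ab i; have [k gh] := bc j; exists k; exact: IH fg gh.
Qed.

Lemma ole_total a b : ~ ole a b -> ole (osucc b) a.
Proof.
elim: a b => X f IH [Y g] /= /existsNP[i /forallNP nfg] _.
exists i; have fg j : ole (osucc (g j)) (f i) by exact: IH.
case: (f i) fg => Z h fg; move=> j; exact: (fg j tt).
Qed.

Lemma SU_ge_ole d a b (p : ctype L d) : ole a b -> SU_ge b p -> SU_ge a p.
Proof.
elim: a b p => X f IH [Y g] p /= ab bp i; have [j fg] := ab i.
by have [q [pq qj]] := bp j; exists q; split=> //; exact: IH fg qj.
Qed.

Lemma ole_onat m n : m <= n -> ole (onat m) (onat n).
Proof.
by elim: m n => [|m IH] [|n] // mn []; exists tt; exact: IH.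
Qed.

End Rank.

Theorem theorem1 (L : vocabulary) (M : structure L)
    (M_countable : countable [set: M])
    (L_binary : binary L)
    (M_homogeneous : homogeneous M)
    (M_simple : simple_structure M) :
  supersimple (Th M) /\
  exists r : nat, SU_rank_eq (Th M) (onat r) /\ `I_r #<= stone 2 (Th M).
Proof.
have SU d (p : ctype L d) := @SU_eq_nat _ _ L_binary M_homogeneous M_simple d p.
split.
  split; first by case: M_simple.
  by move=> d p /SU[n]; exists (onat n).
have [B BP] := @SU_bounded _ _ L_binary M_homogeneous M_simple 1.
(* The rank is the largest n with [Q n]: it is attained by some 1-type, which gives both the lower
   bound on the supremum and the comparison with S_2. *)
pose Q n := exists P : ctype L 1,
  exists2 p, stone 1 (Th M) p & over_empty (Th M) p P /\ SU_ge (onat n) P.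
have Q0 : exists n, `[< Q n >].
  have [x0 _] := simple_structure_inhabited M_simple.
  exists 0; apply/asboolP; pose c (i : 'I_1) := x0.
  pose pr : set M := set0.
  have ctP : exists (N : structure L) (e : M -> N) (c' : 'I_1 -> N), elementary e /\
    tp (fun a : {a | pr a} => sval a) c = tp (fun a : {a | pr a} => e (sval a)) c'.
    by exists M, id, c.
  exists (CType ctP), [set f | sat f c]; first by exists M; split=> //; exists c.
  by split=> [|[]//]; split=> // f; apply: iff_sym; exact: sat_rename.
have QB n : `[< Q n >] -> n <= B.
  by move=> /asboolP[P [p _ [[MP _ _]]]]; exact: BP.
case: (ex_maxnP Q0 QB) => r /asboolP[P [p Sp [Pp Pr]]] rmax.
exists r; split; last first.
  have [MP _ _] := Pp.
  exact: (types_card L_binary M_homogeneous M_simple MP Pr).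
split=> [p' Sp' P' Pp'|b].
  have [MP' _ _] := Pp'; have [n P'n] := SU _ _ MP'.
  exists (onat n); split=> //; apply: ole_onat; apply: rmax; apply/asboolP.
  by exists P', p' => //; case: P'n.
(* Here b' is the rank of [P], which reaches r; were r not at most b', then b' + 1 would be at most
   r and SU(P) at least b' + 1. *)
move=> /(_ p Sp P Pp)[b' [[_ Pb'] bb']]; apply: ole_trans bb'.
apply: contrapT => /ole_total /SU_ge_ole h; apply: Pb'; exact: h.
Qed.
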